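(* Let $0\le\alpha<d$, $1<p\le q<\infty$, $1\le r,s\le\infty$, and let $(u,\sigma)$ be a pair of weights on $\mathbb R^d$. For a cube $Q\subset\mathbb R^d$ let $$\mathcal A_{Q,\sigma}^\alpha f(x):=|Q|^{\alpha/d}\Big(\frac1{|Q|}\int_Q f\sigma\Big)\mathbf 1_Q(x).$$ Then $$\sup_Q\big\|\mathcal A_{Q,\sigma}^\alpha\big\|_{L^{p,r}_{\sigma^{1/p}}\to L^{q,s}_{u^{1/q}}}\approx [(u,\sigma)]_{\mathsf A^\alpha_{(p,r),(q,s)}},$$ where the supremum is over all cubes $Q$ and the constants of comparability depend only on $p,q,r,s$ (both sides may be $+\infty$).
   Context: A weight is a measurable function on $\mathbb R^d$ with values in $(0,\infty)$ almost everywhere; cubes have sides parallel to the axes. For a measurable $f$ on $\mathbb R^d$ with decreasing rearrangement $f^*$, $\|f\|_{L^{a,b}}:=\big(\frac ba\int_0^\infty[t^{1/a}f^*(t)]^b\frac{dt}t\big)^{1/b}$ for $0<a,b<\infty$, and $\|f\|_{L^{a,\infty}}:=\sup_{t>0}t^{1/a}f^*(t)$. For a weight $w$, $L^{a,b}_w:=\{f: fw\in L^{a,b}(\mathbb R^d)\}$ with $\|f\|_{L^{a,b}_w}:=\|fw\|_{L^{a,b}}$ (with respect to Lebesgue measure). For a cube $Q$, $\|h\|_{L^{a,b}(Q)}:=|Q|^{-1/a}\|h\mathbf 1_Q\|_{L^{a,b}}$. Primes denote conjugate exponents, $1'=\infty$, $\infty'=1$. Define $$[(u,\sigma)]_{\mathsf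 A^\alpha_{(p,r),(q,s)}}:=\sup_Q|Q|^{\frac\alpha d+\frac1q-\frac1p}\,\|u^{1/q}\|_{L^{q,s}(Q)}\,\|\sigma^{1/p'}\|_{L^{p',r'}(Q)}.$$ *)

(* Defs.v *)
From HB Require Import structures.
From mathcomp Require Import all_boot all_order all_algebra.
From mathcomp Require Import all_classical all_reals all_analysis.
From mathcomp Require Import measurable_realfun.

Set Implicit Arguments.
Unset Strict Implicit.
Unset Printing Implicit Defensive.

Import Order.TTheory GRing.Theory Num.Theory.
Import numFieldNormedType.Exports.

Local Open Scope classical_set_scope.
Local Open Scope ring_scope.
Local Open Scope ereal_scope.

Section lebesgue_measure_Rd.
Context {R : realType}.
Local Notation mR := (measurableTypeR R).

Definition tuple_of_pair n (z : mR * n.-tuple mR) : n.+1.-tuple mR :=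
  [the n.+1.-tuple mR of z.1 :: z.2].

Definition pair_of_tuple n (t : n.+1.-tuple mR) : mR * n.-tuple mR :=
  (thead t, [tuple of behead t]).

Lemma tuple_of_pairK n : cancel (@tuple_of_pair n) (@pair_of_tuple n).
Proof.
by case=> x t; rewrite /pair_of_tuple/= theadE; congr pair; exact/val_inj.
Qed.

Lemma pair_of_tupleK n : cancel (@pair_of_tuple n) (@tuple_of_pair n).
Proof. by move=> t; rewrite [RHS]tuple_eta; exact/val_inj. Qed.

Lemma measurable_tuple_of_pair n : measurable_fun setT (@tuple_of_pair n).
Proof. exact: measurable_cons. Qed.

Lemma measurable_pair_of_tuple n : measurable_fun setT (@pair_of_tuple n).
Proof.
apply/measurable_fun_pairP; split => /=; last exact: measurable_behead.
exact: (measurable_tnth ord0).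
Qed.

Section cons_measure.
Variables (n : nat) (m : {sigma_finite_measure set (n.-tuple mR) -> \bar R}).

(* The product of the Lebesgue measure of the line and m, transported to
   (n+1)-tuples. *)
Definition cons_measure : set (n.+1.-tuple mR) -> \bar R :=
  pushforward (@lebesgue_measure R \x m) (@tuple_of_pair n).

Let cons_measure0 : cons_measure set0 = 0.
Proof. by rewrite /cons_measure /pushforward preimage_set0 measure0. Qed.

Let cons_measure_ge0 A : 0 <= cons_measure A.
Proof. by rewrite /cons_measure /pushforward; exact: measure_ge0. Qed.

Let cons_measure_sigma_additive : semi_sigma_additive cons_measure.
Proof.
move=> F mF tF mUF; rewrite /cons_measure /pushforward preimage_bigcup.
have mpre A : measurable A -> measurable (@tuple_of_pair n @^-1` A).
  by move=> mA; rewrite -[X in measurable X]setTI;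
    exact: measurable_tuple_of_pair.
apply: measure_semi_sigma_additive.
- by move=> k; exact: mpre.
- apply/trivIsetP => /= i j _ _ ij; rewrite -preimage_setI.
  by move/trivIsetP : tF => /(_ _ _ _ _ ij) ->//; rewrite preimage_set0.
- by rewrite -preimage_bigcup; exact: mpre.
Qed.

HB.instance Definition _ := isMeasure.Build _ _ _ cons_measure
  cons_measure0 cons_measure_ge0 cons_measure_sigma_additive.

Let cons_measure_sigma_finite : sigma_finite setT cons_measure.
Proof.
pose l : {sigma_finite_measure set mR -> \bar R} := @lebesgue_measure R.
have /sigma_finiteP[F [TF ndF Foo]] := sigma_finiteT l.
have /sigma_finiteP[G [TG ndG Goo]] := sigma_finiteT m.
exists (fun k => @pair_of_tuple n @^-1` (F k `*` G k)).
  rewrite -preimage_bigcup -[LHS](preimage_setT (@pair_of_tuple n)).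
  congr (_ @^-1` _); rewrite -setXTT TF TG predeqE => -[x y]; split.
    move=> [/= [i _ Fix] [j _ Gjy]]; exists (maxn i j) => //; split.
    - by move: x Fix; exact/subsetPset/ndF/leq_maxl.
    - by move: y Gjy; exact/subsetPset/ndG/leq_maxr.
  by move=> [i _ []/= ? ?]; split; exists i.
move=> k; have [mF Fk] := Foo k; have [mG Gk] := Goo k; split.
  rewrite -[X in measurable X]setTI; apply: measurable_pair_of_tuple => //.
  exact: measurableX.
rewrite /cons_measure /pushforward -comp_preimage.
rewrite (_ : _ \o _ = id) ?preimage_id//; last first.
  by apply/funext => z /=; rewrite tuple_of_pairK.
by rewrite product_measure1E// lte_mul_pinfty// ge0_fin_numE.
Qed.

HB.instance Definition _ := Measure_isSigmaFinite.Build _ _ _ cons_measure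
  cons_measure_sigma_finite.

End cons_measure.

(* The Lebesgue measure on the Borel sets of d-tuples, as an iterated product. *)
Fixpoint borel_lebesgue_measure (d : nat) :
    {sigma_finite_measure set (d.-tuple mR) -> \bar R} :=
  match d with
  | 0%N => \d_ ([tuple] : 0.-tuple mR)
  | d'.+1 => cons_measure (borel_lebesgue_measure d')
  end.

Lemma borel_lebesgue_measure_box d (A : 'I_d -> set mR) :
  (forall i, measurable (A i)) ->
  borel_lebesgue_measure d [set x | forall i, A i (tnth x i)] =
  \prod_(i < d) lebesgue_measure (A i).
Proof.
elim: d A => [|d ih] A mA.
  rewrite big_ord0 /= diracE.
  by rewrite mem_set//; case.
rewrite big_ord_recl /= /cons_measure /pushforward.
rewrite -(ih (fun i => A (lift ord0 i)))//.
rewrite -(@product_measure1E _ _ _ _ _ _ (borel_lebesgue_measure d)).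
- congr (_ _); apply/seteqP; split => -[x t] /=.
    move=> h; split; first exact: (h ord0).
    by move=> i; have := h (lift ord0 i); rewrite /tuple_of_pair tnthS.
  move=> [h0 h] i; case: (unliftP ord0 i) => [j ->|->]//.
  by rewrite /tuple_of_pair tnthS.
- exact: mA.
- rewrite [X in measurable X](_ : _ = \big[setI/setT]_(i < d)
    ((fun x : d.-tuple mR => tnth x i) @^-1` A (lift ord0 i))).
    apply: bigsetI_measurable => i _; rewrite -[X in measurable X]setTI.
    exact: measurable_tnth.
  rewrite -bigcap_seq; apply/seteqP; split => x /= Ax i.
    by move=> _; exact: Ax.
  by apply: Ax; rewrite /= mem_index_enum.
Qed.

End lebesgue_measure_Rd.

Definition Rd_display (R : realType) (d : nat) : measure_display :=
  caratheodory_display (mu_ext (@borel_lebesgue_measure R d)).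

(* R^d with the sigma-algebra of Lebesgue (not only Borel) measurable sets: the
   Caratheodory measurable sets of the outer measure induced by
   borel_lebesgue_measure. *)
Definition Rd (R : realType) (d : nat) : measurableType (Rd_display R d) :=
  caratheodory_type (mu_ext (@borel_lebesgue_measure R d)).

Definition lebesgue_measure_Rd (R : realType) (d : nat) :
    {measure set (Rd R d) -> \bar R} :=
  @completed_measure_extension _ _ R (@borel_lebesgue_measure R d).

Section cubes.
Context {R : realType} {d : nat}.
Local Notation mR := (measurableTypeR R).

Definition cube (c : d.-tuple mR) (l : R) : set (Rd R d) :=
  [set x : d.-tuple mR |
    forall i, `[tnth c i, (tnth c i + l)%R]%classic (tnth x i)].

Definition cubes : set (set (Rd R d)) :=
  [set Q | exists c l, (0 < l)%R /\ Q = cube c l].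

Let measurable_borel_cube c l :
  measurable (cube c l : set (d.-tuple mR)).
Proof.
rewrite [X in measurable X](_ : _ = \big[setI/setT]_(i < d)
    ((fun x : d.-tuple mR => tnth x i) @^-1`
      `[tnth c i, (tnth c i + l)%R]%classic)).
  apply: bigsetI_measurable => i _; rewrite -[X in measurable X]setTI.
  by apply: measurable_tnth => //; exact: measurable_itv.
rewrite -bigcap_seq; apply/seteqP; split => x /= Ax i.
  by move=> _; exact: Ax.
by apply: Ax; rewrite /= mem_index_enum.
Qed.

Lemma measurable_cube Q : cubes Q -> measurable Q.
Proof.
move=> [c [l [_ ->]]]; apply: caratheodory_measurable_mu_ext.
exact: measurable_borel_cube.
Qed.

Lemma lebesgue_measure_Rd_cube c l : (0 < l)%R ->
  lebesgue_measure_Rd R d (cube c l) = (l ^+ d)%:E.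
Proof.
move=> l0.
transitivity (borel_lebesgue_measure d (cube c l : set (d.-tuple mR))).
  by apply: measurable_mu_extE; exact: measurable_borel_cube.
rewrite [LHS](@borel_lebesgue_measure_box R d
  (fun i => `[tnth c i, (tnth c i + l)%R]%classic))//.
rewrite (eq_bigr (fun=> l%:E)) => [|i _].
  by rewrite prodEFin prodr_const card_ord.
by rewrite lebesgue_measure_itv/= lte_fin ltrDl l0 -EFinB addrAC subrr add0r.
Qed.

End cubes.

Section lorentz.
Context {disp : measure_display} {T : measurableType disp} {R : realType}.
Variable mu : {measure set T -> \bar R}.
Implicit Types (f h w : T -> \bar R) (a : R) (b : \bar R).

Definition decreasing_rearrangement f (t : R) : \bar R :=
  ereal_inf [set y%:E | y in
    [set y : R | (0 <= y)%R /\ mu [set x | y%:E < `|f x|] <= t%:E]].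

(* Meant for b > 0; the value at b = -oo is a dummy. *)
Definition lorentz_norm a b f : \bar R :=
  match b with
  | b'%:E => ((b' / a)%:E * \int[@lebesgue_measure R]_(t in `]0%R, +oo[)
      (((t `^ a^-1)%:E * decreasing_rearrangement f t) `^ b' * (t^-1)%:E))
        `^ b'^-1
  | +oo => ereal_sup [set (t `^ a^-1)%:E * decreasing_rearrangement f t |
      t in `]0%R, +oo[%classic]
  | -oo => 0
  end.

Definition weighted_lorentz_norm a b w f : \bar R :=
  lorentz_norm a b (fun x => f x * w x).

Definition averaged_lorentz_norm (Q : set T) a b h : \bar R :=
  mu Q `^ (- a^-1) * lorentz_norm a b (fun x => h x * (\1_Q x)%:E).

Definition weight w : Prop :=
  measurable_fun setT w /\ {ae mu, forall x, 0 < w x < +oo}.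

Definition operator_norm (NX NY : (T -> \bar R) -> \bar R)
    (A : (T -> \bar R) -> T -> \bar R) : \bar R :=
  ereal_sup [set NY (A f) | f in
    [set f : T -> \bar R | measurable_fun setT f /\ NX f <= 1]].

End lorentz.

Section two_weight.
Context {R : realType} {d : nat}.
Local Notation leb := (lebesgue_measure_Rd R d).
Implicit Types (Q : set (Rd R d)) (u sigma f : Rd R d -> \bar R).

(* When f * sigma is not absolutely integrable on Q, the integral is infinite:
   it is -oo if both the positive and the negative parts have integral +oo. The
   Lorentz norm of averaging_operator alpha Q sigma f is then +oo. *)
Definition averaging_operator (alpha : R) Q sigma f : Rd R d -> \bar R :=
  fun x => leb Q `^ (alpha / d%:R) *
    ((leb Q)^-1 * \int[leb]_(y in Q) (f y * sigma y)) * (\1_Q x)%:E.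

Definition averaging_operator_norm (alpha p q : R) (r s : \bar R) u sigma Q :
    \bar R :=
  operator_norm (weighted_lorentz_norm leb p r (fun x => sigma x `^ p^-1))
    (weighted_lorentz_norm leb q s (fun x => u x `^ q^-1))
    (averaging_operator alpha Q sigma).

Definition A_characteristic (alpha p q : R) (r s : \bar R) u sigma : \bar R :=
  let p' := fine (hoelder_conjugate p%:E) in
  let r' := hoelder_conjugate r in
  ereal_sup [set leb Q `^ (alpha / d%:R + q^-1 - p^-1) *
      averaged_lorentz_norm leb Q q s (fun x => u x `^ q^-1) *
      averaged_lorentz_norm leb Q p' r' (fun x => sigma x `^ p'^-1)
    | Q in cubes].

End two_weight.

(* Main.v *)
(* The operator maps f to a multiple of the indicator of Q, so its norm is
   |Q|^(alpha/d - 1) times the L^(q,s) norm of u^(1/q) on Q times the norm of the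
   functional f |-> int_Q f sigma. Writing f sigma = g h with
   g = f sigma^(1/p) and h = sigma^(1/p') 1_Q, the latter is the norm of h as a
   functional on L^(p,r), which is comparable to its L^(p',r') norm. The upper
   bound is Hölder's inequality: int |g h| is at most a constant times
   int g^* h^*, to which Young's inequality for dt/t applies. For the lower bound,
   the L^(p',r') norm of h is a supremum of sums over the dyadic levels 2^k of
   (2^k |{h > 2^k}|^(1/p'))^r', and it is almost attained by the test functions
   max_k c_k 1_{h > 2^k}. Only finitely many levels enter each of
   them, so the lower bound also covers infinite norms. *)

Require Import Defs.
From HB Require Import structures.
From mathcomp Require Import all_boot all_order all_algebra.
From mathcomp Require Import all_classical all_reals all_analysis.
From mathcomp Require Import measurable_realfun.
From mathcomp Require Import ring lra.

Import Order.TTheory GRing.Theory Num.Theory.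
Import numFieldNormedType.Exports.

Set Implicit Arguments.
Unset Strict Implicit.
Unset Printing Implicit Defensive.

Local Open Scope classical_set_scope.
Local Open Scope ring_scope.
Local Open Scope ereal_scope.

(** * Dyadic levels *)

(** Infinite values shape the argument: both sides may be [+oo], while 0 times [+oo] is 0. The
    product in the characteristic is harmless only because both of its norms are strictly positive,
    the weights being positive almost everywhere on a cube of positive measure. For the lower bound
    a real [z] below a possibly infinite norm is fixed, and finitely many levels already reach it.
    One device serves both halves. The powers of 2 below [y] sum to at most 2 y, and twice that sum,
    once enough levels are included, is at least any given z < y. Fatou's lemma carries such sums
    through integrals although they do not converge to [y]. This also explains the constants: 16 =
    2^4 in the rearrangement inequality, for two functions, each approximated once on the space and
    once on the half-line; 1/8 in the lower bound, where a factor 4 is lost in the Lorentz norm of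
    [h] and a factor 2 in its pairing with the test function. Hölder's inequality and its converse
    are proved over an arbitrary measure space, with constants chosen beforehand, so these depend on
    exponents only. *)

Section dyadic.
Context {R : realType}.
Implicit Types (x y w : \bar R) (z b : R).

(** Replaces a possibly infinite factor by the reals below it. If [y] is infinite and [x] positive,
    letting [z] grow forces [w] to be infinite too. *)
Lemma lee_mul_approx x y w : 0 <= x -> 0 <= w ->
  (forall z, (0 <= z)%R -> z%:E < y -> z%:E * x <= w) -> y * x <= w.
Proof.
move=> x0 w0 h.
have [->|xn0] := eqVneq x 0; first by rewrite mule0.
have {xn0}x0 : 0 < x by rewrite lt_def xn0.
have [y0|y0] := leP y 0; first by rewrite (le_trans _ w0)// mule_le0_ge0// ltW.
case: w w0 h => [w|_ _|//]; last by rewrite leey.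
rewrite lee_fin => w0 h.
case: x x0 h => [x| |//]; last first.
  move=> _ h; have [z /andP[z0 zy]] : exists z, (0 < z)%R && (z%:E < y).
    case: y y0 {h} => [y||//]; last by exists 1%R; rewrite ltry ltr01.
    by rewrite lte_fin => y0; exists (y / 2)%R; rewrite lte_fin; lra.
  by have := h z (ltW z0) zy; rewrite gt0_muley ?lte_fin// leye_eq.
rewrite lte_fin => x0 h.
case: y y0 h => [y| |//].
  rewrite lte_fin => y0 h; rewrite -EFinM lee_fin -ler_pdivlMr//.
  rewrite leNgt; apply/negP => hlt.
  have wx0 : (0 <= w / x)%R by rewrite divr_ge0// ltW.
  have := h ((w / x + y) / 2)%R.
  rewrite lte_fin -EFinM lee_fin -ler_pdivlMr// => /(_ ltac:(lra) ltac:(lra)).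
  lra.
move=> _ h; have w1 : (0 <= (w + 1) / x)%R by apply: divr_ge0; lra.
have := h _ w1 (ltry _); rewrite -EFinM lee_fin divfK ?gt_eqF// => ?; exfalso; lra.
Qed.

(** The level 2^(k - n) with natural exponents only: the indices k < [n.*2] run from 2^-n to 2^(n -
    1), so a growing [n] exhausts both ends. *)
Definition dyadic (n k : nat) : R := 2 ^+ k / 2 ^+ n.

Lemma dyadic_gt0 n k : (0 < dyadic n k)%R.
Proof. by rewrite divr_gt0 ?exprn_gt0. Qed.

(** Geometric growth: the largest level not above [y] dominates the sum of all smaller ones. *)
Lemma dyadic_sum_le n m y : 0 <= y ->
  (\sum_(k < m) dyadic n k * ((dyadic n k)%:E <= y)%E%:R)%:E <= 2%:E * y.
Proof.
move=> y0; elim: m => [|m ih]; first by rewrite big_ord0; exact: mule_ge0.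
rewrite big_ord_recr/=; case: (leP _ y) => [hm|_]; last by rewrite mulr0 addr0.
apply: (@le_trans _ _ (2%:E * (dyadic n m)%:E)); last by rewrite lee_pmul2l.
rewrite -EFinM lee_fin mulr1 mulrDl mul1r lerD2r.
apply: (@le_trans _ _ (\sum_(k < m) dyadic n k)%R).
  apply: ler_sum => k _; case: (leP _ y) => _; rewrite ?mulr1 ?mulr0//.
  exact/ltW/dyadic_gt0.
elim: {ih hm} m => [|m ih]; first by rewrite big_ord0 ltW// dyadic_gt0.
rewrite big_ord_recr/= (_ : dyadic n m.+1 = dyadic n m + dyadic n m)%R.
  by rewrite lerD2r.
by rewrite /dyadic exprS -mulrA; ring.
Qed.

(** A single term suffices: the largest level not above [z] is strictly below [y], and its double
    exceeds [z]. *)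
Lemma dyadic_approx b y z : (0 < b)%R -> (0 <= z)%R -> z%:E < y ->
  exists N, forall n, (N <= n)%N -> (z `^ b <= 2 `^ b *
    \sum_(k < n.*2) dyadic n k `^ b * ((dyadic n k)%:E < y)%E%:R)%R.
Proof.
move=> b0; rewrite le_eqVlt => /predU1P[<- _|z0 zy].
  exists 0%N => n _; rewrite powR0 ?gt_eqF// mulr_ge0 ?powR_ge0//.
  by apply: sumr_ge0 => k _; rewrite mulr_ge0 ?powR_ge0.
(* From this index on 2^-n < z < 2^n, so [z] lies between two consecutive levels, the lower of which
   has index below [n.*2]. *)
exists (Num.bound z + Num.bound z^-1)%N => n hn.
have hz : (z < 2 ^+ n)%R.
  rewrite (lt_trans (archi_boundP (ltW z0)))//.
  rewrite -natrX ltr_nat (leq_ltn_trans _ (ltn_expl n _))//.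
  by rewrite (leq_trans _ hn)// leq_addr.
have hzV : (z^-1 < 2 ^+ n)%R.
  have zV0 : (0 <= z^-1)%R by rewrite invr_ge0 ltW.
  rewrite (lt_trans (archi_boundP zV0))//.
  rewrite -natrX ltr_nat (leq_ltn_trans _ (ltn_expl n _))//.
  by rewrite (leq_trans _ hn)// leq_addl.
have n0 : (0 < n)%N.
  by rewrite (leq_trans _ hn)// addn_gt0 /Num.bound.
pose P k := (z < dyadic n k.+1)%R.
have PN : P n.*2.-1.
  by rewrite /P prednK ?double_gt0// /dyadic -addnn exprD mulfK.
have exP : exists k, P k by exists n.*2.-1.
case: (ex_minnP exP) => k Pk kmin; have kn := kmin _ PN.
have {}kn : (k < n.*2)%N by rewrite (leq_ltn_trans kn)// prednK// double_gt0.
have kz : (dyadic n k <= z)%R.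
  case: k Pk kmin {kn} => [_ _|k _ kmin].
    by rewrite /dyadic expr0 mul1r invf_ple ?posrE ?exprn_gt0// ltW.
  rewrite leNgt; apply/negP => /kmin; by rewrite ltnn.
rewrite (bigD1 (Ordinal kn))//= (le_lt_trans _ zy) ?lee_fin// mulr1 mulrDr.
rewrite -powRM//; last exact/ltW/dyadic_gt0.
rewrite ler_wpDr//; last first.
  rewrite ge0_ler_powR ?nnegrE ?(ltW b0) ?(ltW z0)//.
  - by rewrite mulr_ge0// ltW// dyadic_gt0.
  - by move: Pk; rewrite /P /dyadic exprS -mulrA => /ltW.
rewrite mulr_ge0 ?powR_ge0// sumr_ge0// => i _.
by rewrite mulr_ge0 ?powR_ge0.
Qed.

End dyadic.

(** * The decreasing rearrangement *)

Section rearrangement.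
Context {disp : measure_display} {T : measurableType disp} {R : realType}.
Variable mu : {measure set T -> \bar R}.
Implicit Types (f g h : T -> \bar R) (t y K : R).

Definition level f y : set T := [set x | y%:E < `|f x|].

Lemma measurable_level f y : measurable_fun setT f -> measurable (level f y).
Proof.
move=> mf; rewrite /level -[X in measurable X]setTI.
by apply: emeasurable_fun_o_infty => //; exact: measurableT_comp.
Qed.

Lemma rearrangement_ge0 f t : 0 <= decreasing_rearrangement mu f t.
Proof. by apply/ereal_infP => _ [y [y0 _] <-]; rewrite lee_fin. Qed.

Lemma rearrangement_ge f t y : measurable_fun setT f ->
  t%:E < mu (level f y) -> y%:E <= decreasing_rearrangement mu f t.
Proof.
move=> mf tmu; apply/ereal_infP => _ [z [z0 zt] <-]; rewrite lee_fin leNgt.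
apply/negP => zy; move: tmu; rewrite ltNge => /negP; apply.
apply: (le_trans _ zt); apply: le_measure; rewrite ?inE.
- exact: measurable_level.
- exact: measurable_level.
- by move=> x; apply: lt_trans; rewrite lte_fin.
Qed.

Lemma lt_rearrangement f t y : (0 <= y)%R ->
  y%:E < decreasing_rearrangement mu f t -> t%:E < mu (level f y).
Proof.
move=> y0; rewrite ltNge; apply: contraNlt => h.
by apply: ereal_inf_lbound; exists y.
Qed.

Lemma rearrangement_le_of_level f t y : (0 <= y)%R ->
  mu (level f y) <= t%:E -> decreasing_rearrangement mu f t <= y%:E.
Proof.
by move=> y0 h; rewrite leNgt; apply/negP => /(lt_rearrangement y0); rewrite ltNge h.
Qed.

Lemma rearrangement_nincr f t t' : (t <= t')%R ->
  decreasing_rearrangement mu f t' <= decreasing_rearrangement mu f t.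
Proof.
move=> tt'; apply: ereal_inf_le_tmp => _ [y [y0 yt] <-]; exists y => //; split=> //.
by rewrite (le_trans yt)// lee_fin.
Qed.

Lemma measurable_rearrangement f :
  measurable_fun setT (decreasing_rearrangement mu f).
Proof.
apply: (measurability _ (ErealGenCInfty.measurableE R)) => //.
move=> _ [_ [y ->] <-]; rewrite setTI; apply: is_interval_measurable.
move=> a b /= ha hb c /andP[ac cb]; move: hb.
rewrite /= !in_itv/= !andbT => /le_trans; apply.
exact: rearrangement_nincr.
Qed.

(** Domination is asked only almost everywhere, since weights are positive and finite only almost
    everywhere; the part of one level set outside the other is then negligible. *)
Lemma ae_level_le f g y K : measurable_fun setT f -> measurable_fun setT g ->
  (0 < K)%R -> {ae mu, forall x, `|f x| <= K%:E * `|g x|} ->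
  mu (level f (K * y)%R) <= mu (level g y).
Proof.
move=> mf mg K0 fg.
have mf' := measurable_level (K * y) mf; have mg' := measurable_level y mg.
rewrite -(setUIDK (level f (K * y)) (level g y)).
apply: (@le_trans _ _ (mu (level f (K * y) `&` level g y) +
    mu (level f (K * y) `\` level g y))).
  by apply: measureU2; [exact: measurableI|exact: measurableD].
rewrite [X in _ + X](_ : _ = 0) ?adde0.
  by apply: le_measure; rewrite ?inE//; exact: measurableI.
apply: measure_negligible; first exact: measurableD.
case: fg => N [mN N0 fgN]; exists N; split => // x [/= fx gx]; apply: fgN => /= h.
apply: gx; rewrite /level/= -(@lte_pmul2l _ K%:E)// (lt_le_trans fx)//.
Qed.

Lemma rearrangement_le f g K t : measurable_fun setT f -> measurable_fun setT g ->
  (0 < K)%R -> {ae mu, forall x, `|f x| <= K%:E * `|g x|} ->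
  decreasing_rearrangement mu f t <= K%:E * decreasing_rearrangement mu g t.
Proof.
move=> mf mg K0 fg; rewrite -lee_pdivrMl//; apply/ereal_infP => _ [y [y0 yt] <-].
rewrite lee_pdivrMl//; apply: ereal_inf_lbound; exists (K * y)%R => //.
by split; [rewrite mulr_ge0// ltW|exact: le_trans (ae_level_le _ _ _ _ _) yt].
Qed.

End rearrangement.

(** * Lorentz norms *)

Section lorentz_integral.
Context {R : realType}.
Implicit Types (a b e m K : R) (phi psi : R -> \bar R).
Local Notation leb := (@lebesgue_measure R).

Definition lorentz_integral a b phi : \bar R :=
  \int[leb]_(t in `]0%R, +oo[) (((t `^ a^-1)%:E * phi t) `^ b * (t^-1)%:E).

Lemma measurable_lorentz_integrand a b phi : measurable_fun setT phi ->
  measurable_fun (`]0%R, +oo[%classic : set R)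
    (fun t => ((t `^ a^-1)%:E * phi t) `^ b * (t^-1)%:E).
Proof.
move=> mphi; apply: emeasurable_funM; last first.
  apply/measurable_EFinP.
  apply: (eq_measurable_fun (fun t : R => t `^ (-1))%R); last first.
    by apply: measurable_funTS; exact: measurable_powR.
  by move=> t; rewrite inE/= in_itv/= andbT => t0; rewrite powR_inv1// ltW.
apply: measurable_funTS.
apply: (measurableT_comp (measurable_poweR _)).
apply: emeasurable_funM => //; apply/measurable_EFinP; exact: measurable_powR.
Qed.

Lemma lorentz_integrand_ge0 a b phi t : (0 < t)%R ->
  0 <= ((t `^ a^-1)%:E * phi t) `^ b * (t^-1)%:E.
Proof. by move=> t0; rewrite mule_ge0 ?poweR_ge0// lee_fin invr_ge0 ltW. Qed.

Lemma lorentz_integral_ge0 a b phi : 0 <= lorentz_integral a b phi.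
Proof.
apply: integral_ge0 => t /=; rewrite in_itv/= andbT.
exact: lorentz_integrand_ge0.
Qed.

Lemma lee_poweR b (x y : \bar R) : (0 <= b)%R -> 0 <= x -> x <= y ->
  x `^ b <= y `^ b.
Proof.
move=> b0 x0 xy; apply: gt0_ler_poweR => //.
  by rewrite in_itv/= x0 leey.
by rewrite in_itv/= (le_trans x0 xy) leey.
Qed.

Lemma lorentz_integral_le a b phi psi : (0 <= b)%R ->
  measurable_fun setT phi -> measurable_fun setT psi ->
  (forall t, 0 <= phi t) -> (forall t, (0 < t)%R -> phi t <= psi t) ->
  lorentz_integral a b phi <= lorentz_integral a b psi.
Proof.
move=> b0 mphi mpsi phi0 h; apply: ge0_le_integral => //.
- by move=> t /=; rewrite in_itv/= andbT; exact: lorentz_integrand_ge0.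
- exact: measurable_lorentz_integrand.
- exact: measurable_lorentz_integrand.
move=> t /=; rewrite in_itv/= andbT => t0.
apply: lee_wpmul2r; first by rewrite lee_fin invr_ge0 ltW.
apply: lee_poweR => //; first by rewrite mule_ge0// lee_fin powR_ge0.
by apply: lee_wpmul2l; [rewrite lee_fin powR_ge0|exact: h].
Qed.

Lemma lorentz_integralZ a b K phi : (0 <= b)%R -> (0 <= K)%R ->
  measurable_fun setT phi -> (forall t, 0 <= phi t) ->
  lorentz_integral a b (fun t => K%:E * phi t) =
  (K `^ b)%:E * lorentz_integral a b phi.
Proof.
move=> b0 K0 mphi phi0; rewrite -ge0_integralZl//.
- apply: eq_integral => t _; rewrite muleCA (@poweRM _ K%:E) ?lee_fin//.
    by rewrite poweR_EFin muleA.
  by rewrite mule_ge0// lee_fin powR_ge0.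
- exact: measurable_lorentz_integrand.
- by move=> t /=; rewrite in_itv/= andbT; exact: lorentz_integrand_ge0.
- by rewrite lee_fin powR_ge0.
Qed.

Lemma lorentz_integrandE a b phi t : (0 < t)%R -> (0 < b)%R -> 0 <= phi t ->
  ((t `^ a^-1)%:E * phi t) `^ b * (t^-1)%:E =
  (t `^ (b / a - 1))%:E * phi t `^ b.
Proof.
move=> t0 b0 phi0; rewrite poweRM ?lee_fin ?powR_ge0// poweR_EFin muleAC -EFinM.
congr (_%:E * _); rewrite -powRrM powRD; last by rewrite (gt_eqF t0) implybT.
by rewrite powR_inv1 ?(ltW t0)// (mulrC b).
Qed.

(** For e < 1 the integrand is singular at 0, so the fundamental theorem of calculus is applied on
    [m / (n + 1), m] and monotone convergence gives the limit. *)
Lemma integral_powR_le e m : (0 < e)%R -> (0 <= m)%R ->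
  \int[leb]_(t in `]0%R, m]) (t `^ (e - 1))%:E <= (m `^ e / e)%:E.
Proof.
move=> e0; rewrite le_eqVlt => /predU1P[<-|m0].
  rewrite set_itv_ge -?leNgt ?bnd_simp// integral_set0 lee_fin.
  by rewrite divr_ge0 ?powR_ge0// ltW.
pose F n : set R := `[(m / n.+1%:R)%R, m]%classic.
have F0 n : (0 < m / n.+1%:R)%R by rewrite divr_gt0.
have UF : `]0%R, m]%classic = \bigcup_n F n.
  apply/seteqP; split => t /=; rewrite in_itv/=.
    move=> /andP[t0 tm]; exists (Num.bound (m / t)) => //=; rewrite /F/= in_itv/= tm andbT.
    rewrite ler_pdivrMr// mulrC -ler_pdivrMr// ltW//.
    rewrite (lt_le_trans (archi_boundP _))// ?ler_nat//.
    by rewrite divr_ge0// ltW.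
  by move=> [n _]; rewrite /F/= in_itv/= => /andP[h ->]; rewrite (lt_le_trans _ h).
have mpow D : measurable_fun D (fun t : R => (t `^ (e - 1))%:E).
  by apply/measurable_EFinP/measurable_funTS; exact: measurable_powR.
rewrite UF; have ndF : nondecreasing_seq F.
  move=> i j ij; rewrite subsetEset => t; rewrite /F/= !in_itv/= => /andP[h ->].
  rewrite andbT (le_trans _ h)// ler_pM2l// lef_pV2 ?posrE//.
  by rewrite ler_nat.
have cvgF : \int[leb]_(t in F i) (t `^ (e - 1))%:E @[i --> \oo] -->
    \int[leb]_(t in \bigcup_i F i) (t `^ (e - 1))%:E.
  apply: ge0_nondecreasing_set_cvg_integral => //.
  - by move=> i; exact: measurable_itv.
  - by move=> i; exact: mpow.
  - by move=> i t _; rewrite lee_fin powR_ge0.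
rewrite -(cvg_lim _ cvgF)//; apply: lime_le; first by apply/cvg_ex; eexists; exact: cvgF.
apply: nearW => n.
(* For n = 0 the interval is the single point [m], which the fundamental theorem does not cover. *)
have [->|n0] := eqVneq n 0%N.
  by rewrite /F divr1 set_itv1 integral_set1 lee_fin divr_ge0 ?powR_ge0// ltW.
have lt_m : (m / n.+1%:R < m)%R.
  by rewrite ltr_pdivrMr// ltr_pMr// ltr1n ltnS lt0n.
have dpow c (t : R) : (0 < t)%R -> derivable (fun x : R => x `^ c)%R t 1.
  by move=> t0; apply: derivable_powR; rewrite in_itv/= t0.
have cpow c (t : R) : (0 < t)%R -> {for t, continuous (fun x : R => x `^ c)%R}.
  move=> t0; apply: differentiable_continuous; apply/derivable1_diffP; exact: dpow.
pose G (t : R) : R := (e^-1 * t `^ e)%R.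
have cG t : (0 < t)%R -> {for t, continuous G}.
  by move=> t0; apply: cvgM; [exact: cvg_cst|exact: cpow].
rewrite (@continuous_FTC2 _ _ G)//.
- rewrite lee_fin /G mulrC gerBl mulr_ge0 ?powR_ge0// invr_ge0 ltW//.
- apply: continuous_in_subspaceT => t; rewrite inE/= in_itv/= => /andP[h _].
  by apply: cpow; rewrite (lt_le_trans _ h).
- split.
  + move=> t; rewrite in_itv/= => /andP[h _]; apply: derivableM => //.
    by apply: dpow; rewrite (lt_trans _ h).
  + by apply: cvg_at_right_filter; exact: cG.
  + by apply: cvg_at_left_filter; exact: cG.
- move=> t; rewrite in_itv/= => /andP[h _]; have t0 := lt_trans (F0 n) h.
  rewrite /G derive1E deriveM//; last exact: dpow.
  rewrite derive_cst scaler0 addr0 -derive1E powR_derive1 ?in_itv/= ?t0//.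
  by rewrite /GRing.scale/= mulrA mulVf ?mul1r// gt_eqF.
Qed.

End lorentz_integral.

(** * Lorentz integrals of functions dominated by step functions *)

Section levels.
Context {R : realType}.
Implicit Types (a b e m K : R) (phi psi : R -> \bar R).
Local Notation leb := (@lebesgue_measure R).

Lemma integral_powR_levels_le e N (w m : 'I_N -> R) : (0 < e)%R ->
  (forall k, (0 <= w k)%R) -> (forall k, (0 <= m k)%R) ->
  \int[leb]_(t in `]0%R, +oo[)
    ((t `^ (e - 1))%:E * (\sum_k w k * (t < m k)%R%:R)%:E) <=
  (e^-1 * \sum_k w k * m k `^ e)%:E.
Proof.
move=> e0 w0 m0; pose f k (t : R) := (t `^ (e - 1) * (t < m k)%R%:R)%R.
have mf k : measurable_fun (`]0%R, +oo[%classic : set R) (EFin \o f k).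
  apply/measurable_EFinP/measurable_funTS; apply: measurable_funM.
    exact: measurable_powR.
  rewrite (_ : (fun t => _) = \1_(`]-oo, m k[%classic : set R)).
    by apply: measurable_indic; exact: measurable_itv.
  by apply/funext => t; rewrite indicE mem_setE in_itv.
have f0 k t : (0 <= f k t)%R by rewrite mulr_ge0 ?powR_ge0.
rewrite [leLHS](_ : _ = \int[leb]_(t in `]0%R, +oo[)
    (\sum_k (w k)%:E * (f k t)%:E)); last first.
  apply: eq_integral => t _; rewrite -EFinM mulr_sumr -sumEFin; apply: eq_bigr => k _.
  by rewrite -EFinM /f mulrCA.
rewrite ge0_integral_sum//; last 2 first.
- by move=> k; apply: measurable_funeM; exact: mf.
- by move=> k t _; rewrite -EFinM lee_fin mulr_ge0.
rewrite mulr_sumr -sumEFin; apply: lee_sum => k _.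
rewrite ge0_integralZl//; [|exact: mf|by move=> t _; rewrite lee_fin|by rewrite lee_fin].
rewrite mulrCA EFinM; apply: lee_wpmul2l; first by rewrite lee_fin.
rewrite mulrC; apply: le_trans (integral_powR_le e0 (m0 k)).
rewrite (_ : `]0%R, m k]%classic =
    `]0%R, +oo[%classic `&` `]-oo, m k]%classic); last first.
  by apply/seteqP; split => t /=; rewrite !in_itv/= andbT => /andP.
rewrite integral_mkcondr; apply: ge0_le_integral => //.
- by move=> t _; rewrite lee_fin.
- exact: mf.
- apply/measurable_restrict => //.
  by apply/measurable_EFinP/measurable_funTS; exact: measurable_powR.
- move=> t _; rewrite patchE /f mem_setE in_itv/=.
  case: (ltP t (m k)) => [/ltW ->|_]; rewrite ?mulr1// mulr0.
  by case: ifP => // _; rewrite lee_fin powR_ge0.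
Qed.

(** Integrating t^(b / a - 1) up to [m k] produces the factor a / b, which cancels the normalization
    b / a of the Lorentz norm. *)
Lemma lorentz_integral_levels_le a b N (c m : 'I_N -> R) phi :
  (0 < a)%R -> (0 < b)%R -> (forall k, (0 <= m k)%R) ->
  measurable_fun setT phi -> (forall t, 0 <= phi t) ->
  (forall t, (0 < t)%R -> phi t `^ b <= (\sum_k c k `^ b * (t < m k)%R%:R)%:E) ->
  lorentz_integral a b phi <= (a / b * \sum_k c k `^ b * m k `^ (b / a))%:E.
Proof.
move=> a0 b0 m0 mphi phi0 h; have ba0 : (0 < b / a)%R by rewrite divr_gt0.
rewrite -invf_div.
apply: le_trans (integral_powR_levels_le ba0 (fun k => powR_ge0 (c k) b) m0).
apply: ge0_le_integral => //.
- by move=> t /=; rewrite in_itv/= andbT; exact: lorentz_integrand_ge0.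
- exact: measurable_lorentz_integrand.
- apply/measurable_EFinP/measurable_funTS; apply: measurable_funM.
    exact: measurable_powR.
  apply: measurable_sum => k; apply: measurable_funM => //.
  rewrite (_ : (fun t => _) = \1_(`]-oo, m k[%classic : set R)).
    by apply: measurable_indic; exact: measurable_itv.
  by apply/funext => t; rewrite indicE mem_setE in_itv.
- move=> t /=; rewrite in_itv/= andbT => t0; rewrite lorentz_integrandE//.
  by apply: lee_wpmul2l; [rewrite lee_fin powR_ge0|exact: h].
Qed.

End levels.

(** * Comparison and positivity of Lorentz norms *)

Section lorentz_norm_theory.
Context {disp : measure_display} {T : measurableType disp} {R : realType}.
Variable mu : {measure set T -> \bar R}.
Implicit Types (f g h : T -> \bar R) (a t y K : R).
Local Notation leb := (@lebesgue_measure R).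

Lemma lorentz_norm_finE a b f : lorentz_norm mu a b%:E f =
  ((b / a)%:E * lorentz_integral a b (decreasing_rearrangement mu f)) `^ b^-1.
Proof. by []. Qed.

Lemma lorentz_norm_ge0 a b f : 0 <= lorentz_norm mu a b f.
Proof.
case: b => [b| |] //=; first exact: poweR_ge0.
apply: le_ereal_sup_tmp; eexists; first by exists 1%R => //=; rewrite in_itv/= ltr01.
by rewrite mule_ge0 ?lee_fin ?powR_ge0// rearrangement_ge0.
Qed.

(** Serves as homogeneity, by varying [K], and, with K = 1, as invariance under changes on a null
    set. *)
Lemma lorentz_norm_le a b f g K : (0 < a)%R -> 1 <= b ->
  measurable_fun setT f -> measurable_fun setT g ->
  (0 < K)%R -> {ae mu, forall x, `|f x| <= K%:E * `|g x|} ->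
  lorentz_norm mu a b f <= K%:E * lorentz_norm mu a b g.
Proof.
move=> a0; case: b => [b| |//]; last first.
  move=> _ mf mg K0 fg; apply/ereal_supP => _ [t/= + <-].
  rewrite in_itv/= andbT => t0.
  apply: (@le_trans _ _ (K%:E * ((t `^ a^-1)%:E * decreasing_rearrangement mu g t))).
    rewrite muleCA; apply: lee_wpmul2l; first by rewrite lee_fin powR_ge0.
    exact: rearrangement_le.
  apply: lee_wpmul2l; first by rewrite lee_fin ltW.
  by apply: ereal_sup_ubound; exists t => //=; rewrite in_itv/= t0.
rewrite lee_fin => b1 mf mg K0 fg; rewrite !lorentz_norm_finE.
have b0 : (0 < b)%R by rewrite (lt_le_trans _ b1).
have ba0 : (0 <= b / a)%R by rewrite divr_ge0// ltW.
have -> : K%:E = (K `^ b)%:E `^ b^-1.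
  by rewrite poweR_EFin -powRrM divff ?gt_eqF// powRr1// ltW.
rewrite -poweRM ?lee_fin ?powR_ge0//; last first.
  by rewrite mule_ge0 ?lee_fin ?lorentz_integral_ge0.
apply: lee_poweR; first by rewrite invr_ge0 ltW.
  by rewrite mule_ge0 ?lee_fin ?lorentz_integral_ge0.
rewrite muleCA; apply: lee_wpmul2l; first by rewrite lee_fin.
have mg' : measurable_fun setT (decreasing_rearrangement mu g).
  exact: measurable_rearrangement.
rewrite -lorentz_integralZ ?(ltW b0) ?(ltW K0)//; last first.
  by move=> t; exact: rearrangement_ge0.
apply: lorentz_integral_le; rewrite ?(ltW b0)//.
- exact: measurable_rearrangement.
- exact: measurable_funeM.
- by move=> t; exact: rearrangement_ge0.
- by move=> t t0; exact: rearrangement_le.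
Qed.

Lemma exists_level_gt0 f : measurable_fun setT f -> 0 < mu (level f 0) ->
  exists2 y, (0 < y)%R & 0 < mu (level f y).
Proof.
move=> mf; apply: contraPP => h; apply/negP; rewrite -leNgt.
have -> : level f 0 = \bigcup_n level f n.+1%:R^-1%R.
  apply/seteqP; split => x /=.
    rewrite /level/= => fx; suff [n hn] : exists n, (n.+1%:R^-1)%:E < `|f x| by exists n.
    case: `|f x| fx => [z| |]//; last by move=> _; exists 0%N; rewrite ltry.
    rewrite lte_fin => z0; exists (Num.bound z^-1); rewrite lte_fin invf_plt ?posrE//.
    by rewrite (lt_trans (archi_boundP _)) ?invr_ge0 ?(ltW z0)// ltr_nat.
  by move=> [n _]; rewrite /level/=; apply: lt_trans; rewrite lte_fin invr_gt0.
have mUf : measurable (\bigcup_n level f n.+1%:R^-1%R).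
  by apply: bigcup_measurable => n _; exact: measurable_level.
rewrite (_ : mu _ = 0)//; apply: measure_negligible => //.
apply: negligible_bigcup => n; apply/negligibleP; first exact: measurable_level.
apply/eqP; rewrite eq_le measure_ge0 andbT leNgt; apply/negP => hn.
by apply: h; exists n.+1%:R^-1%R.
Qed.

(** Excludes the product of 0 and [+oo] from the characteristic, so that an infinite norm of one
    weight makes the whole product infinite. *)
Lemma lorentz_norm_gt0 a b f : (0 < a)%R -> 1 <= b -> measurable_fun setT f ->
  0 < mu (level f 0) -> 0 < lorentz_norm mu a b f.
Proof.
move=> a0 b1 mf /(exists_level_gt0 mf)[y y0 ly].
have [m m0 hm] : exists2 m : R, (0 < m)%R &
    forall t, (t < m)%R -> y%:E <= decreasing_rearrangement mu f t.
  have {}ly : exists2 m : R, (0 < m)%R & m%:E <= mu (level f y).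
    case: (mu (level f y)) ly => [m| |]//; rewrite ?lte_fin.
      by move=> m0; exists m.
    by move=> _; exists 1%R; rewrite ?ltr01// leey.
  case: ly => m m0 lm; exists m => // t tm; apply: rearrangement_ge => //.
  by rewrite (lt_le_trans _ lm)// lte_fin.
case: b b1 => [b| |//] b1; last first.
  apply: (@lt_le_trans _ _ (((m / 2) `^ a^-1)%:E * y%:E)).
    by rewrite -EFinM lte_fin mulr_gt0// powR_gt0// divr_gt0.
  apply: le_ereal_sup_tmp; eexists.
    by exists (m / 2)%R => //=; rewrite in_itv/= divr_gt0.
  by apply: lee_wpmul2l; [rewrite lee_fin powR_ge0|apply: hm; lra].
rewrite lee_fin in b1; have b0 : (0 < b)%R by rewrite (lt_le_trans _ b1).
rewrite lorentz_norm_finE poweR_gt0// mule_gt0//; first by rewrite lte_fin divr_gt0.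
(* On [I] the variable stays away from 0 and from infinity and the rearrangement is at least [y], so
   the integrand has a positive lower bound. *)
pose I := (`]m / 4, m / 2]%classic : set R)%R.
have mI : measurable (I : set (measurableTypeR R)) by exact: measurable_itv.
have m4 : (0 < m / 4)%R by rewrite divr_gt0.
have ID : I `<=` (`]0%R, +oo[%classic : set R).
  by move=> t; rewrite /I/= !in_itv/= andbT => /andP[h _]; rewrite (lt_trans _ h).
have mstar := measurable_rearrangement mu f.
have mint := measurable_lorentz_integrand a b mstar.
apply: (@lt_le_trans _ _ (\int[leb]_(t in I)
    ((((m / 4) `^ a^-1 * y) `^ b * (m / 2)^-1)%R%:E))); last first.
  apply: (@le_trans _ _ (\int[leb]_(t in I)
      (((t `^ a^-1)%:E * decreasing_rearrangement mu f t) `^ b * (t^-1)%:E))).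
    apply: ge0_le_integral => //.
    - by move=> t _; rewrite lee_fin mulr_ge0 ?powR_ge0// invr_ge0 divr_ge0// ltW.
    - by apply: measurable_funS mint.
    move=> t; rewrite /I/= in_itv/= => /andP[ht tm]; have t0 := lt_trans m4 ht.
    rewrite EFinM; apply: lee_pmul.
    - by rewrite lee_fin powR_ge0.
    - by rewrite lee_fin invr_ge0 divr_ge0// ltW.
    - rewrite -poweR_EFin EFinM; apply: lee_poweR; first exact: ltW.
        by rewrite -EFinM lee_fin mulr_ge0 ?powR_ge0// ltW.
      apply: lee_pmul; rewrite ?lee_fin ?powR_ge0 ?(ltW y0)//.
        by rewrite ge0_ler_powR ?nnegrE ?invr_ge0// ltW.
      by apply: hm; lra.
    - by rewrite lee_fin lef_pV2// posrE divr_gt0.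
  apply: ge0_subset_integral => //.
  by move=> t /=; rewrite in_itv/= andbT; exact: lorentz_integrand_ge0.
rewrite integral_cst// mule_gt0//.
  by rewrite lte_fin mulr_gt0 ?powR_gt0 ?mulr_gt0 ?powR_gt0 ?invr_gt0 ?divr_gt0.
have := @lebesgue_measure_itv R `](m / 4)%R, (m / 2)%R].
rewrite /= lte_fin ifT; last lra.
by move=> ->; rewrite -EFinB lte_fin; lra.
Qed.

End lorentz_norm_theory.

(** * Hölder's inequality in Lorentz spaces *)

Section fatou_consequences.
Context {R : realType}.

Lemma limn_einf_ge (u : (\bar R)^nat) (x : \bar R) N :
  (forall n, (N <= n)%N -> x <= u n) -> x <= limn_einf u.
Proof.
move=> h; rewrite limn_einf_lim; apply: lime_ge; first exact: is_cvg_einfs.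
near=> n; apply/ereal_infP => _ [k /= nk <-]; apply: h.
by rewrite (leq_trans _ nk)//; near: n; exact: nbhs_infty_ge.
Unshelve. all: by end_near. Qed.

Lemma limn_einf_le (u : (\bar R)^nat) (x : \bar R) :
  (forall n, u n <= x) -> limn_einf u <= x.
Proof.
move=> h; rewrite limn_einf_lim; apply: lime_le; first exact: is_cvg_einfs.
apply: nearW => n; apply: le_trans (h n); apply: ereal_inf_lbound.
by exists n => /=.
Qed.

Lemma le_limn_einf (u v : (\bar R)^nat) :
  (forall n, u n <= v n) -> limn_einf u <= limn_einf v.
Proof.
move=> uv; rewrite !limn_einf_lim; apply: lee_lim; [exact: is_cvg_einfs..|].
apply: nearW => n; apply/ereal_infP => _ [k nk <-]; apply: le_trans (uv k).
by apply: ereal_inf_lbound; exists k.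
Qed.

(** Only [f] <= liminf [u n] is required, so approximations that are off by a constant factor can
    stand in for a convergent sequence. *)
Lemma fatou_le d (T : measurableType d) (mu : {measure set T -> \bar R})
    (D : set T) (f : T -> \bar R) (u : (T -> \bar R)^nat) (B : \bar R) :
  measurable D -> measurable_fun D f -> (forall n, measurable_fun D (u n)) ->
  (forall x, D x -> 0 <= f x) -> (forall n x, D x -> 0 <= u n x) ->
  (forall x, D x -> f x <= limn_einf (u^~ x)) ->
  (forall n, \int[mu]_(x in D) u n x <= B) ->
  \int[mu]_(x in D) f x <= B.
Proof.
move=> mD mf muu f0 u0 fu uB.
apply: (@le_trans _ _ (\int[mu]_(x in D) limn_einf (u^~ x))).
  apply: ge0_le_integral => //.
  rewrite (_ : (fun x => _) = (fun x => - limn_esup (fun n => - u n x))).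
    apply: measurableT_comp => //; apply: measurable_fun_limn_esup => n.
    exact: measurableT_comp.
  by apply/funext => x; rewrite limn_esupN oppeK.
apply: (le_trans (fatou mu mD muu u0)); exact: limn_einf_le.
Qed.

Lemma indic_pred T (P : pred T) x : \1_[set y | P y] x = (P x)%:R :> R.
Proof.
rewrite indicE; case: (boolP (P x)) => Px; first by rewrite mem_set.
by rewrite memNset//=; exact/negP.
Qed.

Lemma integral_sum_indic d (T : measurableType d)
    (mu : {measure set T -> \bar R}) (D : set T) (I : finType)
    (c : I -> R) (A : I -> set T) :
  measurable D -> (forall i, (0 <= c i)%R) -> (forall i, measurable (A i)) ->
  \int[mu]_(x in D) (\sum_i c i * \1_(A i) x)%:E =
  \sum_i (c i)%:E * mu (A i `&` D).
Proof.
move=> mD c0 mA.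
have mi i : measurable_fun D (fun x => (\1_(A i) x)%:E : \bar R).
  by apply/measurable_EFinP; exact: measurable_indic.
rewrite (_ : \int[mu]_(x in D) _ =
    \int[mu]_(x in D) \sum_i (c i)%:E * (\1_(A i) x)%:E); last first.
  by apply: eq_integral => x _; rewrite -sumEFin.
rewrite ge0_integral_sum//; last 2 first.
- by move=> i; exact: measurable_funeM.
- by move=> i x _; rewrite -EFinM lee_fin mulr_ge0.
apply: eq_bigr => i _; rewrite ge0_integralZl ?lee_fin//.
by rewrite integral_indic.
Qed.

End fatou_consequences.

(** * The Hardy-Littlewood rearrangement inequality up to a constant *)

Section hardy_littlewood.
Context {disp : measure_display} {T : measurableType disp} {R : realType}.
Variable mu : {measure set T -> \bar R}.
Implicit Types (f g h : T -> \bar R) (a t : R) (y : \bar R).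
Local Notation leb := (@lebesgue_measure R).
Local Notation star := (decreasing_rearrangement mu).

Definition dyadic_sum n y : R :=
  (\sum_(k < n.*2) dyadic n k * ((dyadic n k)%:E < y)%E%:R)%R.

Lemma dyadic_sum_ge0 n y : (0 <= dyadic_sum n y)%R.
Proof. by apply: sumr_ge0 => k _; rewrite mulr_ge0// ltW// dyadic_gt0. Qed.

Lemma dyadic_sum_le2 n y : 0 <= y -> (dyadic_sum n y)%:E <= 2%:E * y.
Proof.
move=> y0; apply: le_trans (dyadic_sum_le n n.*2 y0); rewrite lee_fin.
apply: ler_sum => k _; rewrite ler_pM2l ?dyadic_gt0// ler_nat.
by case: ltP => // /ltW ->.
Qed.

Lemma dyadic_sum_ge z y : (0 <= z)%R -> z%:E < y ->
  exists N, forall n, (N <= n)%N -> (z <= 2 * dyadic_sum n y)%R.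
Proof.
move=> z0 zy; have [N hN] := dyadic_approx ltr01 z0 zy; exists N => n /hN.
rewrite !powRr1//; congr (_ <= _ * _)%R; apply: eq_bigr => k _.
by rewrite powRr1// ltW// dyadic_gt0.
Qed.

Lemma dyadic_sumM n y y' : (dyadic_sum n y * dyadic_sum n y' =
  \sum_(p : 'I_n.*2 * 'I_n.*2) (dyadic n p.1 * dyadic n p.2) *
    (((dyadic n p.1)%:E < y) && ((dyadic n p.2)%:E < y'))%E%:R)%R.
Proof.
rewrite /dyadic_sum big_distrlr/= pair_big/=; apply: eq_bigr => p _.
by rewrite mulrACA -natrM mulnb.
Qed.

Lemma mule_le_dyadic_sums y y' : 0 <= y -> 0 <= y' ->
  y * y' <= limn_einf (fun n => (4 * (dyadic_sum n y * dyadic_sum n y'))%:E).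
Proof.
move=> y0 y'0.
have D0 : 0 <= limn_einf (fun n => (4 * (dyadic_sum n y * dyadic_sum n y'))%:E).
  by apply: (@limn_einf_ge _ _ _ 0) => n _; rewrite lee_fin !mulr_ge0 ?dyadic_sum_ge0.
apply: lee_mul_approx => // z z0 zy; rewrite muleC.
apply: lee_mul_approx => // z' z'0 zy'.
have [N hN] := dyadic_sum_ge z0 zy; have [N' hN'] := dyadic_sum_ge z'0 zy'.
apply: (@limn_einf_ge _ _ _ (maxn N N')) => n; rewrite geq_max => /andP[/hN h /hN' h'].
rewrite -EFinM lee_fin (_ : 4 = 2 * 2)%R; last ring.
by rewrite mulrACA mulrC ler_pM.
Qed.

(** Meant for [x] the measure of an intersection of two level sets and [y], [y'] their measures: the
    set on the right contains all t with 0 < t < x. This is the passage from the measure space to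
    the half-line. *)
Lemma lebesgue_measure_levels_ge (x y y' : \bar R) : 0 <= x -> x <= y -> x <= y' ->
  x <= leb ([set t : R | (t%:E < y) && (t%:E < y')] `&` `]0%R, +oo[).
Proof.
move=> x0 xy xy'.
have hs (B : set R) : measurable (B : set (measurableTypeR R)) ->
    B `<=` [set t : R | (0 < t)%R && (t%:E < x)] ->
    leb B <= leb ([set t : R | (t%:E < y) && (t%:E < y')] `&` `]0%R, +oo[).
  move=> mB h; apply: le_measure; rewrite ?inE//.
    apply: measurableI; last exact: measurable_itv.
    apply: is_interval_measurable => u v /= _ /andP[vy vy'] w /andP[_ wv].
    by apply/andP; split; [apply: le_lt_trans vy|apply: le_lt_trans vy']; rewrite lee_fin.
  move=> t /h/= /andP[t0 tx]; rewrite in_itv/= t0; split => //.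
  by rewrite (lt_le_trans tx xy) (lt_le_trans tx xy').
case: x x0 xy xy' hs => [x| |//] x0 xy xy' hs.
  apply: le_trans (hs `]0%R, x[%classic _ _); last 2 first.
  - exact: measurable_itv.
  - by move=> t /=; rewrite in_itv/= lte_fin.
  rewrite lebesgue_measure_itv/= lte_fin; case: ltP => [_|//].
  by rewrite -EFinB subr0.
apply: le_trans (hs `]0%R, +oo[%classic _ _); last 2 first.
- exact: measurable_itv.
- by move=> t /=; rewrite in_itv/= andbT ltry => ->.
by rewrite lebesgue_measure_itv/= ltry.
Qed.

(* mu is not assumed to be sigma-finite, so the layer-cake formula with Tonelli's
   theorem is replaced by finite dyadic sums and Fatou's lemma, at the price of
   the factor 16. *)
Lemma hardy_littlewood_le g h : measurable_fun setT g -> measurable_fun setT h ->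
  \int[mu]_x (`|g x| * `|h x|) <=
  16%:E * \int[leb]_(t in `]0%R, +oo[) (star g t * star h t).
Proof.
move=> mg mh.
have mabs f : measurable_fun setT f -> measurable_fun setT (fun x => `|f x|).
  by move=> mf; exact: measurableT_comp.
have mdy f n : measurable_fun setT f ->
    measurable_fun setT (fun x => dyadic_sum n `|f x|).
  move=> mf; apply: measurable_sum => k; apply: measurable_funM => //.
  rewrite (_ : (fun x => _) = \1_(level f (dyadic n k))).
    by apply: measurable_indic; exact: measurable_level.
  by apply/funext => x; rewrite /level indic_pred.
have ms f : measurable_fun (`]0%R, +oo[ : set R) (star f).
  by apply: measurable_funTS; exact: measurable_rearrangement.
apply: (@fatou_le _ _ _ _ _ _
  (fun n x => (4 * (dyadic_sum n `|g x| * dyadic_sum n `|h x|))%:E)) => //.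
- by apply: emeasurable_funM; exact: mabs.
- move=> n; apply/measurable_EFinP; apply: measurable_funM => //.
  by apply: measurable_funM; exact: mdy.
- by move=> n x _; rewrite lee_fin !mulr_ge0 ?dyadic_sum_ge0.
- by move=> x _; exact: mule_le_dyadic_sums.
move=> n.
pose c (p : 'I_n.*2 * 'I_n.*2) := (dyadic n p.1 * dyadic n p.2)%R : R.
have c0 p : (0 <= c p)%R by rewrite mulr_ge0// ltW// dyadic_gt0.
pose A (p : 'I_n.*2 * 'I_n.*2) := level g (dyadic n p.1) `&` level h (dyadic n p.2).
have mA p : measurable (A p) by apply: measurableI; exact: measurable_level.
pose S f (k : nat) (t : R) := t%:E < mu (level f (dyadic n k)).
pose B (p : 'I_n.*2 * 'I_n.*2) : set R := [set t | S g p.1 t && S h p.2 t].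
have mB p : measurable (B p : set (measurableTypeR R)).
  apply: is_interval_measurable => u v /= _ /andP[vy vy'] w /andP[_ wv].
  by apply/andP; split; [apply: le_lt_trans vy|apply: le_lt_trans vy']; rewrite lee_fin.
under eq_integral do rewrite EFinM.
rewrite ge0_integralZl//; last 2 first.
- by apply/measurable_EFinP/measurable_funM; exact: mdy.
- by move=> x _; rewrite lee_fin mulr_ge0// dyadic_sum_ge0.
(* One 4 is the loss of approximating the product by dyadic sums on the space; the other will pay
   for bounding dyadic sums by rearrangements. *)
rewrite (_ : 16 = 4 * 4)%R; last ring.
rewrite EFinM -muleA lee_pmul2l//.
rewrite (_ : \int[mu]_x _ = \sum_p (c p)%:E * mu (A p `&` setT)); last first.
  rewrite -integral_sum_indic//; apply: eq_integral => x _; rewrite dyadic_sumM.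
  congr _%:E; apply: eq_bigr => p _; congr (_ * _)%R.
  rewrite (_ : A p = [set z | ((dyadic n p.1)%:E < `|g z|) &&
      ((dyadic n p.2)%:E < `|h z|)]) ?indic_pred//.
  by apply/seteqP; split => z /andP.
rewrite -ge0_integralZl//; last 2 first.
- by apply: emeasurable_funM; exact: ms.
- by move=> t _; rewrite mule_ge0// rearrangement_ge0.
apply: (@le_trans _ _ (\int[leb]_(t in `]0%R, +oo[) (\sum_p c p * \1_(B p) t)%:E)).
  rewrite integral_sum_indic//; apply: lee_sum => p _.
  apply: lee_wpmul2l; first by rewrite lee_fin.
  rewrite setIT; apply: lebesgue_measure_levels_ge => //.
  - by apply: le_measure; rewrite ?inE//; [exact: measurable_level|exact: subIsetl].
  - by apply: le_measure; rewrite ?inE//; [exact: measurable_level|exact: subIsetr].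
apply: ge0_le_integral => //.
- by move=> t _; rewrite lee_fin sumr_ge0// => p _; rewrite mulr_ge0.
- apply/measurable_EFinP; apply: measurable_sum => p; exact: measurable_funM.
- by apply: measurable_funeM; apply: emeasurable_funM; exact: ms.
move=> t /=; rewrite in_itv/= andbT => t0.
(* At a fixed [t], the condition [S f k t] forces the k-th level to be at most [star f t], so the
   geometric bound applies with [star f t] in place of [y]. *)
have hS f : measurable_fun setT f ->
    (\sum_(k < n.*2) dyadic n k * (S f k t)%:R)%:E <= 2%:E * star f t.
  move=> mf; apply: le_trans (dyadic_sum_le n n.*2 (rearrangement_ge0 mu f t)).
  rewrite lee_fin; apply: ler_sum => k _; rewrite ler_pM2l ?dyadic_gt0// ler_nat.
  by case: (boolP (S f k t)) => // /(rearrangement_ge mf) ->.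
rewrite (_ : 4%:E = 2%:E * 2%:E :> \bar R); last by rewrite -EFinM; congr _%:E; ring.
rewrite muleACA; apply: (@le_trans _ _
  ((\sum_(k < n.*2) dyadic n k * (S g k t)%:R)%:E *
   (\sum_(k < n.*2) dyadic n k * (S h k t)%:R)%:E)); last first.
  by apply: lee_pmul; rewrite ?hS// lee_fin sumr_ge0// => k _;
    rewrite mulr_ge0// ltW// dyadic_gt0.
rewrite -EFinM lee_fin big_distrlr/= pair_big/=.
apply: ler_sum => p _; rewrite /B indic_pred mulrACA -natrM mulnb.
by rewrite /c.
Qed.

End hardy_littlewood.

(** * From rearrangements to Hölder's inequality *)

Section lorentz_hoelder.
Context {disp : measure_display} {T : measurableType disp} {R : realType}.
Variable mu : {measure set T -> \bar R}.
Implicit Types (f g h : T -> \bar R) (a t : R) (x y : \bar R).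
Local Notation leb := (@lebesgue_measure R).
Local Notation star := (decreasing_rearrangement mu).

Lemma lee_young x y (r r' : R) : (0 < r)%R -> (0 < r')%R ->
  (r^-1 + r'^-1 = 1)%R -> 0 <= x -> 0 <= y ->
  x * y <= x `^ r + y `^ r'.
Proof.
move=> r0 r'0 rr'; case: x => [x| |//]; last first.
  move=> _ _; rewrite poweRyr ?gt_eqF// addye ?leey// gt_eqF//.
  by rewrite (lt_le_trans _ (poweR_ge0 _ _)).
rewrite lee_fin => x0; case: y => [y| |//]; last first.
  by move=> _; rewrite poweRyr ?gt_eqF// addey ?leey.
rewrite lee_fin => y0; rewrite !poweR_EFin -EFinM -EFinD lee_fin.
have r1 : (1 <= r)%R.
  by rewrite -invf_le1// -rr' lerDl invr_ge0 ltW.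
have r'1 : (1 <= r')%R.
  by rewrite -invf_le1// -rr' lerDr invr_ge0 ltW.
rewrite (le_trans (conjugate_powR x0 y0 r0 r'0 rr'))//.
by apply: lerD; rewrite ler_pdivrMr// ler_peMr ?powR_ge0.
Qed.

Lemma lorentz_integral_norm_le1 a b f : (0 < a)%R -> (0 < b)%R ->
  lorentz_norm mu a b%:E f <= 1 ->
  lorentz_integral a b (star f) <= (a / b)%:E.
Proof.
move=> a0 b0; rewrite lorentz_norm_finE => h.
have I0 := lorentz_integral_ge0 a b (star f).
have ba0 : (0 < b / a)%R by rewrite divr_gt0.
have : (b / a)%:E * lorentz_integral a b (star f) <= 1.
  have X0 : 0 <= (b / a)%:E * lorentz_integral a b (star f).
    by rewrite mule_ge0// lee_fin ltW.
  have := lee_poweR (ltW b0) (poweR_ge0 _ _) h.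
  by rewrite -poweRrM mulVf ?gt_eqF// poweRe1// poweR1r.
by rewrite -lee_pdivlMl// mule1 invf_div.
Qed.

Lemma star_mulE a a' g h t : (0 < t)%R -> (a^-1 + a'^-1 = 1)%R ->
  star g t * star h t = ((t `^ a^-1)%:E * star g t) *
    ((t `^ a'^-1)%:E * star h t) * (t^-1)%:E.
Proof.
move=> t0 aa'; rewrite muleACA -EFinM -powRD; last by rewrite (gt_eqF t0) implybT.
rewrite aa' powRr1 ?(ltW t0)// muleAC -EFinM divff ?gt_eqF// mul1e//.
Qed.

Lemma measurable_star_integrand a b f :
  measurable_fun (`]0%R, +oo[%classic : set R)
    (fun t => ((t `^ a^-1)%:E * star f t) `^ b * (t^-1)%:E).
Proof. by apply: measurable_lorentz_integrand; exact: measurable_rearrangement. Qed.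

Lemma measurable_star_mul g h :
  measurable_fun (`]0%R, +oo[ : set R) (fun t => star g t * star h t).
Proof.
by apply: emeasurable_funM; apply: measurable_funTS; exact: measurable_rearrangement.
Qed.

(** The terms [a / r] and [a' / r'] bound the two Lorentz integrals: they invert the normalization b
    / a of a norm that is at most 1. *)
Lemma lorentz_hoelder_fin a a' r r' g h : (0 < a)%R -> (0 < a')%R ->
  (a^-1 + a'^-1 = 1)%R -> (0 < r)%R -> (0 < r')%R -> (r^-1 + r'^-1 = 1)%R ->
  measurable_fun setT g -> measurable_fun setT h ->
  lorentz_norm mu a r%:E g <= 1 -> lorentz_norm mu a' r'%:E h <= 1 ->
  \int[mu]_x (`|g x| * `|h x|) <= (16 * (a / r + a' / r'))%:E.
Proof.
move=> a0 a'0 aa' r0 r'0 rr' mg mh g1 h1.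
apply: (le_trans (hardy_littlewood_le mu mg mh)); rewrite EFinM lee_pmul2l// EFinD.
apply: (@le_trans _ _ (lorentz_integral a r (star g) + lorentz_integral a' r' (star h))).
  rewrite -ge0_integralD//; last 4 first.
  - by move=> t /=; rewrite in_itv/= andbT; exact: lorentz_integrand_ge0.
  - exact: measurable_star_integrand.
  - by move=> t /=; rewrite in_itv/= andbT; exact: lorentz_integrand_ge0.
  - exact: measurable_star_integrand.
  apply: ge0_le_integral => //.
  - by move=> t _; rewrite mule_ge0 ?rearrangement_ge0.
  - exact: measurable_star_mul.
  - by apply: emeasurable_funD; exact: measurable_star_integrand.
  move=> t /=; rewrite in_itv/= andbT => t0; rewrite (star_mulE g h t0 aa').
  have x0 c f : 0 <= (t `^ c)%:E * star f t.
    by rewrite mule_ge0 ?rearrangement_ge0// lee_fin powR_ge0.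
  rewrite -ge0_muleDl ?poweR_ge0//; apply: lee_wpmul2r.
    by rewrite lee_fin invr_ge0 ltW.
  exact: lee_young.
by apply: leeD; exact: lorentz_integral_norm_le1.
Qed.

(** At this endpoint Young's inequality gives way to a pointwise bound: the weak norm keeps t^(1/a')
    [star h t] below 1 for every t > 0. *)
Lemma lorentz_hoelder_1y a a' g h : (0 < a)%R -> (0 < a')%R ->
  (a^-1 + a'^-1 = 1)%R -> measurable_fun setT g -> measurable_fun setT h ->
  lorentz_norm mu a 1 g <= 1 -> lorentz_norm mu a' +oo h <= 1 ->
  \int[mu]_x (`|g x| * `|h x|) <= (16 * a)%:E.
Proof.
move=> a0 a'0 aa' mg mh g1 /ereal_supP h1.
apply: (le_trans (hardy_littlewood_le mu mg mh)); rewrite EFinM lee_pmul2l//.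
have := lorentz_integral_norm_le1 a0 ltr01 g1; rewrite divr1; apply: le_trans.
apply: ge0_le_integral => //.
- by move=> t _; rewrite mule_ge0 ?rearrangement_ge0.
- exact: measurable_star_mul.
- exact: measurable_star_integrand.
move=> t /=; rewrite in_itv/= andbT => t0; rewrite (star_mulE g h t0 aa').
have x0 : 0 <= (t `^ a^-1)%:E * star g t.
  by rewrite mule_ge0 ?rearrangement_ge0// lee_fin powR_ge0.
apply: lee_wpmul2r; first by rewrite lee_fin invr_ge0 ltW.
rewrite poweRe1// -[leRHS]mule1; apply: lee_wpmul2l => //.
by apply: h1; exists t => //=; rewrite in_itv/= t0.
Qed.

End lorentz_hoelder.

Lemma hoelder_conjugate_fin (R : realType) (r : R) : (1 < r)%R ->
  exists r' : R, [/\ hoelder_conjugate r%:E = r'%:E, (1 < r')%R &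
    (r^-1 + r'^-1 = 1)%R].
Proof.
move=> r1; have r10 : (0 < r - 1)%R by rewrite subr_gt0.
exists (r / (r - 1))%R; split.
- rewrite /hoelder_conjugate/= eqe gt_eqF ?(lt_trans ltr01)//.
  by rewrite -EFinB inver subr_eq0 gt_eqF.
- by rewrite ltr_pdivlMr// mul1r ltrBlDr ltrDl.
- by field; apply/andP; split; lra.
Qed.

(** The constant precedes the measure space, hence cannot depend on dimension, cube or weights.
    Since the sum in Young's inequality is not homogeneous, [h] is first divided by [M]. The case of
    infinite [r] exchanges the roles of [g] and [h]. *)
Lemma lorentz_hoelder (R : realType) (p p' : R) (r : \bar R) :
  (0 < p)%R -> (0 < p')%R -> (p^-1 + p'^-1 = 1)%R -> 1 <= r ->
  exists2 C : R, (0 < C)%R &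
  forall disp (T : measurableType disp) (mu : {measure set T -> \bar R})
    (g h : T -> \bar R) (M : R), (0 < M)%R ->
  measurable_fun setT g -> measurable_fun setT h ->
  lorentz_norm mu p r g <= 1 ->
  lorentz_norm mu p' (hoelder_conjugate r) h <= M%:E ->
  \int[mu]_x (`|g x| * `|h x|) <= (C * M)%:E.
Proof.
move=> p0 p'0 pp' r1.
have r'1 := hoelder_conj_ge1 r1.
suff [C C0 hC] : exists2 C : R, (0 < C)%R &
    forall disp (T : measurableType disp) (mu : {measure set T -> \bar R})
      (g h : T -> \bar R), measurable_fun setT g -> measurable_fun setT h ->
    lorentz_norm mu p r g <= 1 -> lorentz_norm mu p' (hoelder_conjugate r) h <= 1 ->
    \int[mu]_x (`|g x| * `|h x|) <= C%:E.
  exists C => // disp T mu g h M M0 mg mh g1 hM.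
  have MV0 : (0 < M^-1)%R by rewrite invr_gt0.
  pose k x := M^-1%:E * h x.
  have mk : measurable_fun setT k by exact: measurable_funeM.
  have k1 : lorentz_norm mu p' (hoelder_conjugate r) k <= 1.
    apply: (@le_trans _ _ (M^-1%:E * lorentz_norm mu p' (hoelder_conjugate r) h)).
      apply: lorentz_norm_le => //; apply: aeW => x.
      by rewrite /k abseM/= gtr0_norm.
    by rewrite lee_pdivrMl// mule1.
  have := hC _ _ mu g k mg mk g1 k1.
  under eq_integral do rewrite /k abseM/= gtr0_norm// muleCA.
  rewrite ge0_integralZl//; last 2 first.
  - by apply: emeasurable_funM; exact: measurableT_comp.
  - by rewrite lee_fin ltW.
  by rewrite lee_pdivrMl// mulrC EFinM.
case: r r1 r'1 => [r| |//] r1 r'1; last first.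
  rewrite hoelder_conjugatey; exists (16 * p')%R; first by rewrite mulr_gt0.
  move=> disp T mu g h mg mh g1 h1.
  under eq_integral do rewrite muleC.
  by apply: (lorentz_hoelder_1y p'0 p0) => //; rewrite addrC.
move: r1; rewrite le_eqVlt => /predU1P[[<-]|r1].
  rewrite hoelder_conjugate1; exists (16 * p)%R; first by rewrite mulr_gt0.
  by move=> disp T mu g h mg mh; exact: lorentz_hoelder_1y.
rewrite lte_fin in r1; have [r' [-> r'1' rr']] := hoelder_conjugate_fin r1.
have r0 := lt_trans ltr01 r1; have r'0 := lt_trans ltr01 r'1'.
exists (16 * (p / r + p' / r'))%R.
  by rewrite mulr_gt0// addr_gt0// divr_gt0.
by move=> disp T mu g h mg mh; exact: lorentz_hoelder_fin.
Qed.

(** * The converse of Hölder's inequality *)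

Section level_max.
Context {disp : measure_display} {T : measurableType disp} {R : realType}.
Variable mu : {measure set T -> \bar R}.
Variable h : T -> \bar R.
Hypotheses (mh : measurable_fun setT h) (h0 : forall x, 0 <= h x).
Hypothesis hoo : mu (level h 0) < +oo.
Implicit Types (a b t y : R).
Local Notation leb := (@lebesgue_measure R).
Local Notation star := (decreasing_rearrangement mu).

(** Real-valued thanks to [hoo], which holds in the application because [h] vanishes off a cube;
    coefficients of test functions can then be powers of masses. *)
Definition level_mass y : R := fine (mu (level h y)).

Lemma level_massE y : (0 <= y)%R -> mu (level h y) = (level_mass y)%:E.
Proof.
move=> y0; rewrite /level_mass fineK// ge0_fin_numE//.
apply: le_lt_trans hoo; apply: le_measure; rewrite ?inE.
- exact: measurable_level.
- exact: measurable_level.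
- by move=> x; rewrite /level/=; apply: le_lt_trans; rewrite lee_fin.
Qed.

Lemma level_mass_ge0 y : (0 <= level_mass y)%R.
Proof. by rewrite fine_ge0. Qed.

Section levels.
Variables (N : nat) (lam c : 'I_N -> R).
Hypotheses (lam0 : forall k, (0 <= lam k)%R) (c0 : forall k, (0 <= c k)%R).

(* A maximum rather than a sum: every set {level_max > y} is then one of the level
   sets of h, so the Lorentz norm of level_max is controlled by the coefficients
   without any assumption on how the masses of the level sets decay. *)
Definition level_max (x : T) : R :=
  \big[Num.max/0%R]_(k < N) (c k * ((lam k)%:E < h x)%E%:R)%R.

Lemma measurable_level_max : measurable_fun setT level_max.
Proof.
rewrite /level_max; elim: (index_enum _) => [|k s ih].
  by rewrite (_ : (fun x => _) = cst 0%R)//; apply/funext => x; rewrite big_nil.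
under eq_fun do rewrite big_cons; apply: measurable_maxr => //.
apply: measurable_funM => //.
rewrite (_ : (fun x => _) = \1_(level h (lam k))).
  by apply: measurable_indic; exact: measurable_level.
by apply/funext => x; rewrite /level indic_pred gee0_abs.
Qed.

Lemma level_max_ge0 x : (0 <= level_max x)%R.
Proof. exact: bigmax_ge_id. Qed.

Lemma level_max_ge k x : (c k * ((lam k)%:E < h x)%E%:R <= level_max x)%R.
Proof. exact: (le_bigmax _ (fun k => c k * ((lam k)%:E < h x)%E%:R)%R). Qed.

Lemma level_max_gt x y : (0 <= y)%R -> (y < level_max x)%R ->
  exists k, (y < c k)%R && ((lam k)%:E < h x).
Proof.
move=> y0; apply: contraPP => hn; apply/negP; rewrite -leNgt.
apply: bigmax_le => // k _; case: ltP => [hk|_]; last by rewrite mulr0.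
rewrite mulr1 leNgt; apply/negP => yk; by apply: hn; exists k; rewrite yk.
Qed.

Lemma star_level_max t : (0 < t)%R -> star (EFin \o level_max) t <=
  (\big[Num.max/0%R]_(k < N) (c k * (t < level_mass (lam k))%R%:R)%R)%:E.
Proof.
move=> t0; set M := \big[_/_]_(k < N) _.
have M0 : (0 <= M)%R by exact: bigmax_ge_id.
apply: rearrangement_le_of_level => //.
have mG : measurable_fun setT (EFin \o level_max).
  by apply/measurable_EFinP; exact: measurable_level_max.
have level_gt x : level (EFin \o level_max) M x ->
    exists k, (M < c k)%R && ((lam k)%:E < h x).
  by rewrite /level/= lte_fin ger0_norm ?level_max_ge0//; exact: level_max_gt.
have [[k0 Mk0]|nk] := pselect (exists k, (M < c k)%R); last first.
  rewrite (_ : level _ _ = set0) ?measure0 ?lee_fin ?(ltW t0)//.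
  apply/seteqP; split => // x /level_gt[k /andP[Mk _]].
  by apply: nk; exists k.
(* The sets of the k with [c k] > [M] are nested, so their union is the one of least [lam]. Its mass
   is at most [t]: otherwise [c k] would enter the maximum [M]. *)
pose k := [arg min_(i < k0 | (M < c i)%R) lam i]%O.
have [Mk kmin] : (M < c k)%R /\ forall j, (M < c j)%R -> (lam k <= lam j)%R.
  by rewrite /k; case: arg_minP.
apply: (@le_trans _ _ (mu (level h (lam k)))).
  apply: le_measure; rewrite ?inE; [exact: measurable_level|exact: measurable_level|].
  move=> x /level_gt[j /andP[/kmin kj]]; rewrite /level/= gee0_abs//.
  by apply: le_lt_trans; rewrite lee_fin.
rewrite level_massE// lee_fin leNgt; apply/negP => tk.
have := le_bigmax 0%R (fun k => c k * (t < level_mass (lam k))%R%:R)%R k.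
by rewrite -/M tk mulr1 leNgt Mk.
Qed.

Lemma powR_bigmax_le (I : finType) b (F : I -> R) : (0 < b)%R ->
  (forall i, 0 <= F i)%R ->
  ((\big[Num.max/0]_i F i) `^ b <= \sum_i F i `^ b)%R.
Proof.
move=> b0 F0.
suff [] : (0 <= \big[Num.max/0]_i F i)%R /\
  ((\big[Num.max/0]_i F i) `^ b <= \sum_i F i `^ b)%R by [].
apply: (big_ind2 (fun x y => (0 <= x)%R /\ (x `^ b <= y)%R)).
- by rewrite powR0 ?gt_eqF.
- move=> x1 x2 y1 y2 [x10 hx] [y10 hy]; rewrite le_max x10; split => //.
  have x20 := le_trans (powR_ge0 _ _) hx; have y20 := le_trans (powR_ge0 _ _) hy.
  by case: (leP x1 y1) => _; [rewrite ler_wpDl|rewrite ler_wpDr].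
- by move=> i _; split.
Qed.

Lemma lorentz_norm_level_max a b : (0 < a)%R -> (0 < b)%R ->
  lorentz_norm mu a b%:E (EFin \o level_max) <=
  ((\sum_k c k `^ b * level_mass (lam k) `^ (b / a)) `^ b^-1)%:E.
Proof.
move=> a0 b0; rewrite lorentz_norm_finE -poweR_EFin.
have ba0 : (0 < b / a)%R by rewrite divr_gt0.
apply: lee_poweR; first by rewrite invr_ge0 ltW.
  by rewrite mule_ge0 ?lorentz_integral_ge0// lee_fin ltW.
rewrite -lee_pdivlMl// -EFinM invf_div.
apply: lorentz_integral_levels_le => //.
- by move=> k; exact: level_mass_ge0.
- exact: measurable_rearrangement.
- by move=> t; exact: rearrangement_ge0.
move=> t t0.
apply: (@le_trans _ _ ((\big[Num.max/0%R]_(k < N)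
    (c k * (t < level_mass (lam k))%R%:R)%R)%:E `^ b)).
  apply: lee_poweR; [exact: ltW|exact: rearrangement_ge0|exact: star_level_max].
rewrite poweR_EFin lee_fin; apply: le_trans (powR_bigmax_le b0 _) _.
  by move=> k; rewrite mulr_ge0.
apply: ler_sum => k _; rewrite powRM//.
by case: ltP => _; rewrite ?powR1 ?powR0 ?mulr1 ?mulr0 ?gt_eqF.
Qed.

Lemma lorentz_norm_level_maxy a (B : R) : (0 < a)%R -> (0 <= B)%R ->
  (forall k, (c k * level_mass (lam k) `^ a^-1 <= B)%R) ->
  lorentz_norm mu a +oo (EFin \o level_max) <= B%:E.
Proof.
move=> a0 B0 hB; apply/ereal_supP => _ [t/= + <-].
rewrite in_itv/= andbT => t0.
have ta0 : (0 < t `^ a^-1)%R by rewrite powR_gt0.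
rewrite -lee_pdivlMl// -EFinM; apply: le_trans (star_level_max t0) _.
rewrite lee_fin; apply: bigmax_le => [|k _].
  by rewrite mulr_ge0// invr_ge0 ltW.
case: ltP => tk; last by rewrite mulr0 mulr_ge0// invr_ge0 ltW.
rewrite mulr1 ler_pdivlMl// mulrC; apply: le_trans (hB k).
apply: ler_wpM2l => //; rewrite ge0_ler_powR ?nnegrE ?invr_ge0 ?(ltW a0) ?(ltW t0)//.
  exact: level_mass_ge0.
exact: ltW.
Qed.

(* h dominates half of the sum of the lam k over the levels below it, while
   level_max is at least c k on the k-th level set. *)
Lemma integral_level_max_ge :
  (forall y : \bar R, 0 <= y ->
    (\sum_k lam k * ((lam k)%:E < y)%E%:R)%:E <= 2%:E * y) ->
  (2^-1 * \sum_k lam k * c k * level_mass (lam k))%:E <=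
  \int[mu]_x ((level_max x)%:E * h x).
Proof.
move=> hlam.
have mG : measurable_fun setT (EFin \o level_max).
  by apply/measurable_EFinP; exact: measurable_level_max.
rewrite EFinM lee_pdivrMl// -ge0_integralZl//; last 2 first.
- exact: emeasurable_funM.
- by move=> x _; rewrite mule_ge0// lee_fin level_max_ge0.
rewrite -sumEFin (eq_bigr (fun k => (lam k * c k)%:E * mu (level h (lam k) `&` setT))).
  rewrite -integral_sum_indic//; last 2 first.
  - by move=> k; rewrite mulr_ge0.
  - by move=> k; exact: measurable_level.
  apply: ge0_le_integral => //.
  - by move=> x _; rewrite lee_fin sumr_ge0// => k _; rewrite !mulr_ge0.
  - apply/measurable_EFinP; apply: measurable_sum => k; apply: measurable_funM => //.
    by apply: measurable_indic; exact: measurable_level.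
  - by apply: measurable_funeM; exact: emeasurable_funM.
  move=> x _; rewrite muleCA.
  apply: (@le_trans _ _ ((level_max x)%:E *
      (\sum_k lam k * ((lam k)%:E < h x)%E%:R)%:E)); last first.
    by apply: lee_wpmul2l; [rewrite lee_fin level_max_ge0|exact: hlam].
  rewrite -EFinM lee_fin mulr_sumr; apply: ler_sum => k _.
  rewrite /level indic_pred gee0_abs//; have := level_max_ge k x.
  by case: ltP => _; rewrite ?mulr0// !mulr1 => ck; rewrite mulrC ler_wpM2r.
by move=> k _; rewrite setIT level_massE// -EFinM.
Qed.

End levels.

(** [dyadic_approx] needs some z strictly below [y]; taking z = y / 2 costs a second factor 2, hence
    4. For infinite [y] every z is allowed. *)
Lemma poweR_le_dyadic b w (y : \bar R) : (0 < b)%R -> (0 < w)%R -> 0 <= y ->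
  w%:E * y `^ b <= limn_einf (fun n => (w * (4 `^ b *
    \sum_(k < n.*2) dyadic n k `^ b * ((dyadic n k)%:E < y)%E%:R))%:E).
Proof.
move=> b0 w0 y0; set L := limn_einf _.
have L0 : 0 <= L.
  apply: (@limn_einf_ge _ _ _ 0) => n _; rewrite lee_fin !mulr_ge0 ?(ltW w0) ?powR_ge0//.
  by apply: sumr_ge0 => k _; rewrite mulr_ge0 ?powR_ge0.
have hL z : (0 <= z)%R -> z%:E < y -> (w * (2 * z) `^ b)%:E <= L.
  move=> z0 zy; have [N hN] := dyadic_approx b0 z0 zy.
  apply: (@limn_einf_ge _ _ _ N) => n /hN h'; rewrite lee_fin ler_pM2l//.
  rewrite powRM// (_ : 4 = 2 * 2)%R; last ring.
  by rewrite powRM// -mulrA ler_wpM2l ?powR_ge0.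
case: y y0 @L L0 hL => [y| |//] y0 L L0 hL; last first.
  rewrite poweRyr ?gt_eqF// gt0_muley// leye_eq; apply/eqP/eq_infty => M.
  have [M0|M0] := leP 0%R M; last by rewrite (le_trans _ L0)// lee_fin ltW.
  (* The z for which w (2 z)^b equals [M]. *)
  have := hL ((M / w) `^ b^-1 / 2)%R; rewrite divr_ge0 ?powR_ge0// ltry.
  move=> /(_ isT isT); rewrite (mulrC 2%R) divfK// -powRrM mulVf ?gt_eqF// powRr1.
    by rewrite mulrC divfK// gt_eqF.
  by rewrite divr_ge0// ltW.
rewrite lee_fin in y0; rewrite poweR_EFin -EFinM.
move: y0; rewrite le_eqVlt => /predU1P[y0|y0].
  by rewrite -y0 powR0 ?gt_eqF// mulr0.
have := hL (y / 2)%R; rewrite lte_fin (mulrC 2%R) divfK//; apply; lra.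
Qed.

(** A level below [star h t] has mass above [t], so powers of the rearrangement are controlled by
    step functions whose integrals are these sums. Finiteness of the norm is a conclusion: read
    contrapositively, a large or infinite norm yields one large finite sum. *)
Lemma lorentz_norm_le_dyadic a b (B : R) : (0 < a)%R -> (0 < b)%R -> (0 <= B)%R ->
  (forall n, \sum_(k < n.*2) dyadic n k `^ b * level_mass (dyadic n k) `^ (b / a)
    <= B `^ b)%R ->
  lorentz_norm mu a b%:E h <= (4 * B)%:E.
Proof.
move=> a0 b0 B0 hB; rewrite lorentz_norm_finE.
have -> : (4 * B)%R = (((4 * B) `^ b) `^ b^-1)%R.
  by rewrite -powRrM divff ?gt_eqF// powRr1// mulr_ge0.
have ba0 : (0 < b / a)%R by rewrite divr_gt0.
rewrite -poweR_EFin; apply: lee_poweR; first by rewrite invr_ge0 ltW.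
  by rewrite mule_ge0 ?lorentz_integral_ge0// lee_fin ltW.
rewrite -lee_pdivlMl// -EFinM.
pose u n (t : R) := (t `^ (b / a - 1) * (\sum_(k < n.*2)
  (4 `^ b * dyadic n k `^ b) * (t < level_mass (dyadic n k))%R%:R))%:E.
apply: (@fatou_le _ _ (measurableTypeR R) leb `]0%R, +oo[%classic _ u) => //.
- exact: measurable_star_integrand.
- move=> n; rewrite /u; apply/measurable_EFinP; apply: measurable_funM.
    by apply: measurable_funTS; exact: measurable_powR.
  apply: measurable_sum => k; apply: measurable_funM => //.
  rewrite (_ : (fun t => _) = \1_(`]-oo, level_mass (dyadic n k)[%classic : set R)).
    by apply: measurable_indic; exact: measurable_itv.
  by apply/funext => t; rewrite indicE mem_setE in_itv.
- by move=> t /=; rewrite in_itv/= andbT; exact: lorentz_integrand_ge0.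
- move=> n t _; rewrite /u lee_fin mulr_ge0 ?powR_ge0// sumr_ge0// => k _.
  by rewrite !mulr_ge0 ?powR_ge0.
- move=> t /=; rewrite in_itv/= andbT => t0.
  rewrite lorentz_integrandE ?rearrangement_ge0//.
  have tp : (0 < t `^ (b / a - 1))%R by rewrite powR_gt0.
  apply: le_trans (poweR_le_dyadic b0 tp (rearrangement_ge0 mu h t)) _.
  apply: le_limn_einf => n; rewrite /u lee_fin ler_wpM2l ?powR_ge0//.
  rewrite mulr_sumr; apply: ler_sum => k _; rewrite mulrA ler_wpM2l ?mulr_ge0 ?powR_ge0//.
  rewrite ler_nat; case: ltP => // hk.
  have d0 : (0 <= dyadic n k :> R)%R by rewrite ltW// dyadic_gt0.
  by have := lt_rearrangement d0 hk; rewrite level_massE// lte_fin => ->.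
- move=> n; apply: le_trans (integral_powR_levels_le ba0 _ _) _.
  + by move=> k; rewrite mulr_ge0 ?powR_ge0.
  + by move=> k; exact: level_mass_ge0.
  rewrite lee_fin ler_pM2l ?invr_gt0// powRM//.
  under eq_bigr do rewrite -mulrA.
  by rewrite -mulr_sumr ler_wpM2l ?powR_ge0.
Qed.

End level_max.

(** * Test functions that nearly attain the dual norm *)

Section duality.
Context {R : realType}.
Implicit Types (p r z : R).

(** A certificate that the functional given by [h] has norm at least [z] on L^(p,r). As [z] is real,
    infinite norms are handled by letting it grow. *)
Definition norming p (r : \bar R) disp (T : measurableType disp)
    (mu : {measure set T -> \bar R}) (h : T -> \bar R) z : Prop :=
  exists g : T -> R, [/\ measurable_fun setT g, forall x, (0 <= g x)%R,
    lorentz_norm mu p r (EFin \o g) <= 1 & z%:E <= \int[mu]_x ((g x)%:E * h x)].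

Section fixed_space.
Context {disp : measure_display} {T : measurableType disp}.
Variables (mu : {measure set T -> \bar R}) (h : T -> \bar R).
Hypotheses (mh : measurable_fun setT h) (h0 : forall x, 0 <= h x).
Hypothesis hoo : mu (level h 0) < +oo.
Variables (p p' : R).
Hypotheses (p0 : (0 < p)%R) (p'0 : (0 < p')%R) (pp' : (p^-1 + p'^-1 = 1)%R).
Local Notation m := (level_mass mu h).

Let m0 y : (0 <= m y)%R. Proof. exact: level_mass_ge0. Qed.

Lemma norming_le0 (r : \bar R) z : 1 <= r -> (z <= 0)%R -> norming p r mu h z.
Proof.
move=> r1 z0; exists (level_max h (fun _ : 'I_0 => 0%R) (fun=> 0%R)); split.
- exact: measurable_level_max.
- by move=> x; exact: level_max_ge0.
- case: r r1 => [r| |//] r1; last first.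
    apply: (@le_trans _ _ 0); last by rewrite lee_fin.
    by apply: lorentz_norm_level_maxy => // -[].
  have r0 : (0 < r)%R by rewrite (lt_le_trans ltr01).
  apply: le_trans (lorentz_norm_level_max mh h0 hoo _ _ p0 r0) _ => //.
  by rewrite big_ord0 powR0 ?invr_eq0 ?gt_eqF// lee_fin.
- apply: (@le_trans _ _ 0); rewrite ?lee_fin//; apply: integral_ge0 => x _.
  by rewrite mule_ge0// lee_fin level_max_ge0.
Qed.

(** A supremum is nearly attained at one [t], so one level [y] suffices, just below the
    rearrangement there; its mass exceeds [t]. The factor 1/2 is that of [integral_level_max_ge]. *)
Lemma norming_1 z : z%:E < 2^-1%:E * lorentz_norm mu p' +oo h -> norming p 1 mu h z.
Proof.
have [z0 _|z0] := leP z 0%R; first exact: norming_le0.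
rewrite lte_pdivlMl// -EFinM.
move=> /ereal_sup_gt[_ [t/= + <-]]; rewrite in_itv/= andbT => t0.
have tp0 : (0 < t `^ p'^-1)%R by rewrite powR_gt0.
rewrite -lte_pdivrMl// -EFinM; set y := (_ * _)%R => hy.
have y0 : (0 <= y)%R by rewrite mulr_ge0 ?mulr_ge0// ?invr_ge0 ltW.
have := lt_rearrangement y0 hy; rewrite (level_massE mh)// lte_fin => tm.
have mp : (0 < m y)%R by rewrite (lt_trans t0).
have c0 : (0 <= m y `^ - p^-1)%R by rewrite powR_ge0.
exists (level_max h (fun _ : 'I_1 => y) (fun=> m y `^ - p^-1)%R); split.
- exact: measurable_level_max.
- by move=> x; exact: level_max_ge0.
- apply: le_trans (lorentz_norm_level_max mh h0 hoo _ _ p0 ltr01) _ => //.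
  rewrite big_ord1 !powRr1 ?div1r ?mulr_ge0 ?powR_ge0//.
  rewrite invr1 powRr1 ?mulr_ge0 ?powR_ge0// powRN mulVf// gt_eqF// powR_gt0//.
- apply: le_trans _ (integral_level_max_ge mh h0 hoo _ _ _) => //.
    rewrite big_ord1 lee_fin.
    have -> : (z = 2^-1 * (y * t `^ p'^-1))%R.
      by rewrite /y; field; rewrite gt_eqF.
    rewrite ler_pM2l// -mulrA ler_wpM2l//.
    rewrite -{2}[m y]powRr1// -powRD; last by rewrite (gt_eqF mp) implybT.
    rewrite (_ : - p^-1 + 1 = p'^-1)%R; last by rewrite -pp'; ring.
    by rewrite ge0_ler_powR ?nnegrE ?invr_ge0 ?(ltW p'0) ?(ltW t0) ?(ltW mp)// ltW.
  move=> x x0; rewrite big_ord1; case: ltP => yx; rewrite ?mulr1 ?mulr0.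
    apply: (le_trans (ltW yx)); rewrite -[leLHS]mul1e; apply: lee_wpmul2r => //.
    by rewrite lee_fin; lra.
  exact: mule_ge0.
Qed.

Let dy0 n : forall k : 'I_n.*2, (0 <= dyadic n k :> R)%R.
Proof. by move=> k; rewrite ltW// dyadic_gt0. Qed.

Lemma norming_y z : z%:E < 8^-1%:E * lorentz_norm mu p' 1 h -> norming p +oo mu h z.
Proof.
have [z0 _|z0] := leP z 0%R; first by apply: norming_le0; rewrite ?leey.
rewrite lte_pdivlMl// -EFinM => hz.
(* If every finite sum were at most 2 z, the norm would be at most 4 (2 z) = 8 z. The 2 is kept for
   the loss in [integral_level_max_ge]. *)
have [n hn] : exists n, (2 * z < \sum_(k < n.*2) dyadic n k `^ 1 *
    m (dyadic n k) `^ (1 / p'))%R.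
  apply: contrapT => hn; move: hz; rewrite ltNge => /negP; apply.
  rewrite (_ : 8 * z = 4 * (2 * z))%R; last ring.
  apply: (lorentz_norm_le_dyadic mh hoo p'0 ltr01); first by rewrite mulr_ge0// ltW.
  move=> n; rewrite powRr1 ?mulr_ge0 ?(ltW z0)// leNgt; apply/negP => hn'.
  by apply: hn; exists n.
pose lam (k : 'I_n.*2) : R := dyadic n k.
(* The largest coefficients with weak norm at most 1. On a level of mass 0 the coefficient is 0 as
   well, because 0 to a negative power is the inverse of 0, which is 0. *)
pose c (k : 'I_n.*2) : R := (m (lam k) `^ - p^-1)%R.
have c0 k : (0 <= c k)%R by rewrite powR_ge0.
have lam0 k : (0 <= lam k)%R by exact: dy0.
exists (level_max h lam c); split.
- exact: measurable_level_max.
- by move=> x; exact: level_max_ge0.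
- apply: lorentz_norm_level_maxy => // k; rewrite /c.
  have [->|mk] := eqVneq (m (lam k)) 0%R.
    by rewrite [X in (_ * X)%R]powR0 ?mulr0// invr_eq0 gt_eqF.
  by rewrite powRN mulVf// powR_eq0 (negbTE mk).
- apply: le_trans _ (integral_level_max_ge mh h0 hoo _ _ _) => //; last first.
    by move=> y y0; exact: dyadic_sum_le2.
  rewrite lee_fin ler_pdivlMl//; apply: (le_trans (ltW hn)).
  apply: ler_sum => k _; rewrite powRr1 ?dy0// -mulrA ler_wpM2l ?dy0// div1r /c.
  have [mk|mk] := eqVneq (m (lam k)) 0%R.
    by rewrite -/(lam k) mk mulr0 powR0// invr_eq0 gt_eqF.
  rewrite -{3}[m (lam k)]powRr1// -powRD; last by rewrite mk implybT.
  by rewrite (_ : - p^-1 + 1 = p'^-1)%R// -pp'; ring.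
Qed.

Lemma norming_fin r r' z : (0 < r)%R -> (0 < r')%R -> (r^-1 + r'^-1 = 1)%R ->
  1 <= r%:E ->
  z%:E < 8^-1%:E * lorentz_norm mu p' r'%:E h -> norming p r%:E mu h z.
Proof.
move=> r0 r'0 rr' r1.
have [z0 _|z0] := leP z 0%R; first exact: norming_le0.
rewrite lte_pdivlMl// -EFinM => hz.
pose S n := (\sum_(k < n.*2) dyadic n k `^ r' * m (dyadic n k) `^ (r' / p') : R)%R.
have [n hn] : exists n, ((2 * z) `^ r' < S n)%R.
  apply: contrapT => hn; move: hz; rewrite ltNge => /negP; apply.
  rewrite (_ : 8 * z = 4 * (2 * z))%R; last ring.
  apply: (lorentz_norm_le_dyadic mh hoo p'0 r'0); first by rewrite mulr_ge0// ltW.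
  move=> n; rewrite leNgt; apply/negP => hn'; by apply: hn; exists n.
have S0 : (0 < S n)%R by rewrite (le_lt_trans _ hn)// powR_ge0.
pose lam (k : 'I_n.*2) : R := dyadic n k.
(* c k is the dual coefficient lam k ^ (r' - 1) * m (lam k) ^ (r' / p' - 1),
   normalized: both sum (c k)^r * m^(r / p) and sum lam k * c k * m are then
   powers of S n. A level set of mass 0 contributes 0, as 0 `^ e = 0 for e != 0. *)
pose A := (S n `^ - r^-1)%R.
pose c (k : 'I_n.*2) : R := (A * (lam k `^ (r' - 1) * m (lam k) `^ (r' / p' - 1)))%R.
have c0 k : (0 <= c k)%R by rewrite !mulr_ge0 ?powR_ge0.
have lam_ge0 k : (0 <= lam k)%R by exact: dy0.
have r'r : ((r' - 1) * r = r')%R.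
  have -> : (r' - 1 = r' * r^-1)%R.
    have -> : (r^-1 = 1 - r'^-1)%R by rewrite -rr' addrK.
    by field; rewrite gt_eqF.
  by rewrite divfK// gt_eqF.
(* The exponent of the mass in c^r m^(r/p); with [r'r] it turns the r-th power sum of the test
   function into a multiple of [S n]. *)
have pr : ((r' / p' - 1) * r + r / p = r' / p')%R.
  have -> : (p^-1 = 1 - p'^-1)%R by rewrite -pp' addrK.
  by rewrite -{2}r'r; ring.
exists (level_max h lam c); split.
- exact: measurable_level_max.
- by move=> x; exact: level_max_ge0.
- apply: le_trans (lorentz_norm_level_max mh h0 hoo _ _ p0 r0) _ => //.
  rewrite (_ : (\sum_k _)%R = 1%R) ?powR1//.
  rewrite (eq_bigr (fun k => A `^ r * (lam k `^ r' * m (lam k) `^ (r' / p'))))%R.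
    rewrite -mulr_sumr -/(S n) /A -powRrM mulNr mulVf ?gt_eqF// powR_inv1 ?(ltW S0)//.
    by rewrite mulVf// gt_eqF.
  move=> k _; rewrite /c powRM ?mulr_ge0 ?powR_ge0// powRM ?powR_ge0//.
  rewrite -!powRrM r'r -!mulrA; congr (_ * (_ * _))%R.
  have [mk|mk] := eqVneq (m (lam k)) 0%R.
    by rewrite mk ![(0 `^ (_ / _))%R]powR0 ?mulr0// gt_eqF// divr_gt0.
  by rewrite -powRD ?pr// mk implybT.
- apply: le_trans _ (integral_level_max_ge mh h0 hoo _ _ _) => //; last first.
    by move=> y y0; exact: dyadic_sum_le2.
  rewrite (eq_bigr (fun k => A * (lam k `^ r' * m (lam k) `^ (r' / p'))))%R; last first.
    move=> k _; rewrite /c mulrCA -!mulrA; congr (_ * _)%R; rewrite !mulrA.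
    rewrite mulr_powRB1 ?lam_ge0// -mulrA; congr (_ * _)%R.
    by rewrite mulrC mulr_powRB1// divr_gt0.
  rewrite -mulr_sumr -/(S n) lee_fin ler_pdivlMl//.
  rewrite -[(A * _)%R]/(S n `^ (- r^-1) * S n)%R -{2}[S n]powRr1 ?(ltW S0)//.
  rewrite -powRD; last by rewrite (gt_eqF S0) implybT.
  rewrite (_ : - r^-1 + 1 = r'^-1)%R; last by rewrite -rr'; ring.
  have -> : (2 * z = ((2 * z) `^ r') `^ r'^-1)%R.
    by rewrite -powRrM divff ?gt_eqF// powRr1// mulr_ge0// ltW.
  by rewrite ge0_ler_powR ?nnegrE ?invr_ge0 ?powR_ge0 ?(ltW r'0) ?(ltW S0)// ltW.
Qed.

End fixed_space.

Lemma exists_norming p p' (r : \bar R) : (0 < p)%R -> (0 < p')%R ->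
  (p^-1 + p'^-1 = 1)%R -> 1 <= r ->
  forall disp (T : measurableType disp) (mu : {measure set T -> \bar R})
    (h : T -> \bar R) z, measurable_fun setT h -> (forall x, 0 <= h x) ->
  mu (level h 0) < +oo ->
  z%:E < 8^-1%:E * lorentz_norm mu p' (hoelder_conjugate r) h ->
  norming p r mu h z.
Proof.
move=> p0 p'0 pp' r1 disp T mu h z mh h0 hoo.
case: r r1 => [r| |//] r1; last by rewrite hoelder_conjugatey; exact: norming_y pp' _.
have := r1; rewrite le_eqVlt => /predU1P[[<-]|].
  rewrite hoelder_conjugate1 => hz; apply: (norming_1 _ _ _ _ p'0) => //.
  apply: (lt_le_trans hz); apply: lee_wpmul2r; first exact: lorentz_norm_ge0.
  by rewrite lee_fin lef_pV2 ?posrE// ler_nat.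
rewrite lte_fin => /hoelder_conjugate_fin[r' [-> r'1 rr']].
apply: (norming_fin _ _ _ _ p'0) => //.
- by rewrite (lt_le_trans ltr01).
- by rewrite (lt_trans ltr01).
Qed.

End duality.

(** * The averaging operator of a single cube *)

Section weights_on_a_set.
Context {disp : measure_display} {T : measurableType disp} {R : realType}.
Variables (mu : {measure set T -> \bar R}) (Q : set T) (v : R).
Hypotheses (mQ : measurable Q) (v0 : (0 < v)%R) (muQ : mu Q = v%:E).

Definition cut_weight (w : T -> \bar R) (e : R) (x : T) : \bar R :=
  w x `^ e * (\1_Q x)%:E.

Lemma cut_weight_ge0 w e x : 0 <= cut_weight w e x.
Proof. by rewrite mule_ge0 ?poweR_ge0. Qed.

Lemma measurable_cut_weight w e : measurable_fun setT w ->
  measurable_fun setT (cut_weight w e).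
Proof.
move=> mw; apply: emeasurable_funM; last by apply/measurable_EFinP; exact: measurable_indic.
exact: (measurableT_comp (measurable_poweR _)).
Qed.

Lemma level_cut_weight_lty w e : measurable_fun setT w ->
  mu (level (cut_weight w e) 0) < +oo.
Proof.
move=> mw; rewrite (@le_lt_trans _ _ (mu Q)) ?muQ ?ltry//.
rewrite -muQ; apply: le_measure; rewrite ?inE//.
  exact/measurable_level/measurable_cut_weight.
move=> x; rewrite /level/= /cut_weight indicE; case: (boolP (x \in Q)).
  by rewrite inE.
by rewrite mule0 abse0 ltxx.
Qed.

(** Up to the null set where the weight fails to be positive, the level set covers all of [Q]. *)
Lemma level_cut_weight_gt0 w e : weight mu w -> 0 < mu (level (cut_weight w e) 0).
Proof.
move=> [mw [N [mN N0 wN]]].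
have mL : measurable (level (cut_weight w e) 0).
  exact/measurable_level/measurable_cut_weight.
rewrite (@lt_le_trans _ _ (mu Q)) ?muQ ?lte_fin//.
rewrite -muQ -[leRHS]adde0 -N0.
apply: (@le_trans _ _ (mu (level (cut_weight w e) 0 `|` N))).
  apply: le_measure; rewrite ?inE//; first exact: measurableU.
  move=> x Qx; have [Nx|Nx] := pselect (N x); [by right|left].
  have /andP[wx _] : 0 < w x < +oo by apply: contrapT => h; apply: Nx; exact: wN.
  rewrite /level/= gee0_abs ?cut_weight_ge0// /cut_weight indicE mem_set// mule1.
  exact: poweR_gt0.
exact: measureU2.
Qed.

Lemma lorentz_norm_cut_weight_gt0 w e a b : (0 < a)%R -> 1 <= b -> weight mu w ->
  0 < lorentz_norm mu a b (cut_weight w e).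
Proof.
move=> a0 b1 ww; apply: lorentz_norm_gt0 => //; last exact: level_cut_weight_gt0.
by case: ww => mw _; exact: measurable_cut_weight.
Qed.

Variables (p p' q k : R) (r s : \bar R) (u sigma : T -> \bar R).
Hypotheses (p0 : (0 < p)%R) (p'0 : (0 < p')%R) (pp' : (p^-1 + p'^-1 = 1)%R).
Hypotheses (q0 : (0 < q)%R) (k0 : (0 < k)%R) (r1 : 1 <= r) (s1 : 1 <= s).
Hypotheses (wu : weight mu u) (wsigma : weight mu sigma).

Let U := cut_weight u q^-1.
Let h := cut_weight sigma p'^-1.
Let I f := \int[mu]_(y in Q) (f y * sigma y).
Let NX f := weighted_lorentz_norm mu p r (fun x => sigma x `^ p^-1) f.
Let NY f := weighted_lorentz_norm mu q s (fun x => u x `^ q^-1)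
  (fun x => k%:E * I f * (\1_Q x)%:E).

Let mu_ : measurable_fun setT u. Proof. by case: wu. Qed.
Let ms_ : measurable_fun setT sigma. Proof. by case: wsigma. Qed.
Let mh : measurable_fun setT h. Proof. exact: measurable_cut_weight. Qed.
Let mU : measurable_fun setT U. Proof. exact: measurable_cut_weight. Qed.
Let mAf f : measurable_fun setT (fun x => k%:E * I f * (\1_Q x)%:E * u x `^ q^-1).
Proof.
apply: emeasurable_funM; last exact: (measurableT_comp (measurable_poweR _)).
by apply: measurable_funeM; apply/measurable_EFinP; exact: measurable_indic.
Qed.

(** Hölder's inequality enters as a hypothesis so that a single [C], fixed beforehand, serves all
    cubes and weights. *)
Lemma averaging_le (C : R) (f : T -> \bar R) : (0 < C)%R ->
  (forall (g h : T -> \bar R) (M : R), (0 < M)%R ->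
    measurable_fun setT g -> measurable_fun setT h ->
    lorentz_norm mu p r g <= 1 ->
    lorentz_norm mu p' (hoelder_conjugate r) h <= M%:E ->
    \int[mu]_x (`|g x| * `|h x|) <= (C * M)%:E) ->
  measurable_fun setT f -> NX f <= 1 ->
  NY f <= C%:E * (k%:E * lorentz_norm mu q s U *
                  lorentz_norm mu p' (hoelder_conjugate r) h).
Proof.
move=> C0 hoelderC mf f1.
have U0 : 0 < lorentz_norm mu q s U by exact: lorentz_norm_cut_weight_gt0.
have h0 : 0 < lorentz_norm mu p' (hoelder_conjugate r) h.
  by apply: lorentz_norm_cut_weight_gt0 => //; exact: hoelder_conj_ge1.
have hM g M M0 mg := hoelderC g h M M0 mg mh.
(* If this norm is infinite, so is the right-hand side, because its other factors are positive. *)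
case: (lorentz_norm mu p' (hoelder_conjugate r) h) h0 hM => [M| |]// M0 hM; last first.
  by rewrite !gt0_muley ?leey// ?mule_gt0 ?lte_fin.
rewrite lte_fin in M0.
have IM : `|I f| <= (C * M)%:E.
  pose g x := f x * sigma x `^ p^-1.
  have mg : measurable_fun setT g.
    by apply: emeasurable_funM => //; exact: (measurableT_comp (measurable_poweR _)).
  have mgh : measurable_fun setT (fun x => `|g x| * `|h x|).
    by apply: emeasurable_funM; exact: measurableT_comp.
  apply: (le_trans (le_abse_integral mu mQ _)).
    by apply: measurable_funTS; exact: emeasurable_funM.
  apply: (le_trans _ (hM g M M0 mg f1 (lexx _))).
  apply: (@le_trans _ _ (\int[mu]_(x in Q) (`|g x| * `|h x|))); last first.
    by apply: ge0_subset_integral => // x _; rewrite mule_ge0.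
  apply: ae_ge0_le_integral => //.
  - apply: measurableT_comp => //; apply: measurable_funTS; exact: emeasurable_funM.
  - exact: measurable_funTS.
  case: wsigma => _; apply: filterS => x /andP[sx _] Qx.
  rewrite -abseM /g /h /cut_weight indicE mem_set// mule1 -muleA -poweRD.
    by rewrite pp' poweRe1// ltW.
  by apply: add_neq0_poweRD_def; rewrite pp' oner_eq0.
rewrite [leRHS](_ : _ = (C * M * k)%:E * lorentz_norm mu q s U); last first.
  by rewrite (muleC _ M%:E) !muleA -!EFinM.
apply: lorentz_norm_le => //; first by rewrite !mulr_gt0.
apply: aeW => x; rewrite !abseM /= gtr0_norm//.
rewrite -!muleA (muleC `|_%:E|) !muleA; apply: lee_wpmul2r => //.
apply: lee_wpmul2r => //.
by rewrite muleC EFinM; apply: lee_wpmul2r => //; rewrite lee_fin ltW.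
Qed.

Lemma averaging_ge (N : \bar R) :
  (forall f, measurable_fun setT f -> NX f <= 1 -> NY f <= N) ->
  8^-1%:E * (k%:E * lorentz_norm mu q s U *
             lorentz_norm mu p' (hoelder_conjugate r) h) <= N.
Proof.
move=> hN.
have approx z : z%:E < 8^-1%:E * lorentz_norm mu p' (hoelder_conjugate r) h ->
    exists f, [/\ measurable_fun setT f, NX f <= 1 & z%:E <= I f].
  move=> hz; have hoo := level_cut_weight_lty p'^-1 ms_.
  have h0 : forall x, 0 <= h x by move=> x; exact: cut_weight_ge0.
  have [g [mg g0 g1 zg]] := exists_norming p0 p'0 pp' r1 mh h0 hoo hz.
  (* Wherever [sigma] is positive and finite, f sigma^(1/p) = g, and f sigma = g h on [Q]; both
     identities hold only almost everywhere. *)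
  pose f x := (g x)%:E * sigma x `^ - p^-1.
  have mEg : measurable_fun setT (EFin \o g) by exact/measurable_EFinP.
  have mf : measurable_fun setT f.
    by apply: emeasurable_funM => //; exact: (measurableT_comp (measurable_poweR _)).
  exists f; split => //.
    apply: (@le_trans _ _ (1%:E * lorentz_norm mu p r (EFin \o g))); last by rewrite mul1e.
    apply: lorentz_norm_le => //.
      by apply: emeasurable_funM => //; exact: (measurableT_comp (measurable_poweR _)).
    case: wsigma => _; apply: filterS => x; rewrite mul1e /f/=.
    move=> /andP[]; case: (sigma x) => [y| |]//; rewrite lte_fin => y0 _.
    rewrite !poweR_EFin powRN -muleA -EFinM mulVf ?mulr1//.
    by rewrite gt_eqF// powR_gt0.
  apply: (le_trans zg).
  rewrite (_ : \int[mu]_x _ = \int[mu]_(x in Q) ((g x)%:E * h x)); last first.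
    rewrite [RHS]integral_mkcond; apply: eq_integral => x _; rewrite patchE.
    case: ifPn => // xQ; rewrite /h /cut_weight indicE (negbTE xQ) mule0 mule0//.
  rewrite le_eqVlt; apply/orP; left; apply/eqP; apply: ae_eq_integral => //.
  - by apply: measurable_funTS; exact: emeasurable_funM.
  - by apply: measurable_funTS; exact: emeasurable_funM.
  case: wsigma => _; apply: filterS => x; rewrite /f/=.
  move=> /andP[+ + Qx]; rewrite /h /cut_weight.
  case: (sigma x) => [y| |]//; rewrite lte_fin => y0 _.
  rewrite indicE mem_set// mule1 !poweR_EFin -muleA -EFinM.
  rewrite -EFinM; congr (_ * _)%:E.
  rewrite -[X in (_ * X)%R]powRr1 ?(ltW y0)// -powRD; last by rewrite (gt_eqF y0) implybT.
  by congr (_ `^ _)%R; rewrite -pp'; ring.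
have h0 : 0 < lorentz_norm mu p' (hoelder_conjugate r) h.
  by apply: lorentz_norm_cut_weight_gt0 => //; exact: hoelder_conj_ge1.
(* [lee_mul_approx] needs a nonnegative bound. Since the dual norm is positive, z = 0 lies strictly
   below an eighth of it and provides a test function. *)
have N0 : 0 <= N.
  have e0 : 0%:E < 8^-1%:E * lorentz_norm mu p' (hoelder_conjugate r) h.
    by rewrite mule_gt0// lte_fin invr_gt0.
  have [f [mf f1 _]] := approx 0%R e0.
  by apply: le_trans (hN f mf f1); exact: lorentz_norm_ge0.
rewrite (muleC _ (lorentz_norm mu p' _ h)) muleA.
apply: lee_mul_approx => //.
  by rewrite mule_ge0 ?lorentz_norm_ge0// lee_fin ltW.
move=> z; rewrite le_eqVlt => /predU1P[<- _|z0 hz]; first by rewrite mul0e.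
have [f [mf f1 zI]] := approx z hz.
apply: (le_trans _ (hN f mf f1)).
have kz0 : (0 < k * z)%R by rewrite mulr_gt0.
rewrite muleA -EFinM (mulrC z) -lee_pdivlMl//.
apply: lorentz_norm_le => //; first by rewrite invr_gt0.
apply: aeW => x; rewrite lee_pdivlMl//.
have I0 : 0 <= I f by apply: le_trans zI; rewrite lee_fin ltW.
rewrite !gee0_abs ?cut_weight_ge0//; last first.
  by rewrite !mule_ge0 ?poweR_ge0// lee_fin ltW.
rewrite /U /cut_weight (muleC (u x `^ _)) !muleA; apply: lee_wpmul2r.
  exact: poweR_ge0.
apply: lee_wpmul2r; first by rewrite lee_fin.
by rewrite EFinM; apply: lee_wpmul2l => //; rewrite lee_fin ltW.
Qed.

End weights_on_a_set.

(** * Specialization to cubes and the comparison of suprema *)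

Section two_weight_on_a_cube.
Context {R : realType} {d : nat}.
Variables (alpha p p' q : R) (r s : \bar R) (u sigma : Rd R d -> \bar R).
Variables (Q : set (Rd R d)) (v : R).
Hypotheses (v0 : (0 < v)%R) (Qv : lebesgue_measure_Rd R d Q = v%:E).
Local Notation leb := (lebesgue_measure_Rd R d).
Let k : R := (v `^ (alpha / d%:R) / v)%R.

Lemma averaging_operatorE f : averaging_operator alpha Q sigma f =
  fun x => k%:E * (\int[leb]_(y in Q) (f y * sigma y)) * (\1_Q x)%:E.
Proof.
apply/funext => x; rewrite /averaging_operator Qv poweR_EFin inver gt_eqF//.
by rewrite muleA -EFinM.
Qed.

(** The averaged norms contribute the exponents -1/q and -1/p', and 1/p + 1/p' = 1, so the total
    power of |Q| is alpha/d - 1, as in the operator. *)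
Lemma A_characteristic_cubeE : (p^-1 + p'^-1 = 1)%R ->
  leb Q `^ (alpha / d%:R + q^-1 - p^-1) *
    averaged_lorentz_norm leb Q q s (fun x => u x `^ q^-1) *
    averaged_lorentz_norm leb Q p' (hoelder_conjugate r) (fun x => sigma x `^ p'^-1) =
  k%:E * lorentz_norm leb q s (cut_weight Q u q^-1) *
    lorentz_norm leb p' (hoelder_conjugate r) (cut_weight Q sigma p'^-1).
Proof.
move=> pp'; rewrite /averaged_lorentz_norm Qv !poweR_EFin.
set X := lorentz_norm _ _ _ _; set Y := lorentz_norm _ _ _ _.
rewrite (muleA _ _ X) -EFinM muleACA -EFinM -[RHS]muleA; congr (_%:E * _).
have powD e e' : (v `^ e * v `^ e' = v `^ (e + e'))%R.
  by rewrite powRD// (gt_eqF v0) implybT.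
rewrite /k -(powR_inv1 (ltW v0)) !powD; congr (_ `^ _)%R.
by have -> : (p'^-1 = 1 - p^-1)%R; [rewrite -pp'; ring|ring].
Qed.

End two_weight_on_a_cube.

Theorem theorem3p2 (R : realType) (p q : R) (r s : \bar R) :
  (1 < p)%R -> (p <= q)%R -> 1 <= r -> 1 <= s ->
  exists c C : R, (0 < c)%R /\ (0 < C)%R /\
  forall (d : nat) (alpha : R) (u sigma : Rd R d -> \bar R),
    (0 <= alpha)%R -> (alpha < d%:R)%R ->
    weight (lebesgue_measure_Rd R d) u ->
    weight (lebesgue_measure_Rd R d) sigma ->
    let N := ereal_sup [set averaging_operator_norm alpha p q r s u sigma Q
                       | Q in cubes] in
    let A := A_characteristic alpha p q r s u sigma in
    c%:E * A <= N /\ N <= C%:E * A.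
Proof.
move=> p1 pq r1 s1.
have [p' [p'E p'1 pp']] := hoelder_conjugate_fin p1.
have p0 := lt_trans ltr01 p1; have p'0 := lt_trans ltr01 p'1.
have q0 := lt_le_trans p0 pq.
have [C C0 hC] := lorentz_hoelder p0 p'0 pp' r1.
(* Both constants are fixed before dimension, [alpha] and weights: 1/8 from [exists_norming], [C]
   from [lorentz_hoelder]. *)
exists 8^-1%R, C; split; first by rewrite invr_gt0.
split=> // d alpha u sigma _ _ wu wsigma; rewrite /A_characteristic p'E -[fine _]/p'.
have cubeE (Q : set (Rd R d)) : cubes Q -> exists2 v, (0 < v)%R &
    measurable Q /\ lebesgue_measure_Rd R d Q = v%:E.
  move=> cQ; have mQ := measurable_cube cQ.
  case: cQ mQ => c [l [l0 ->]] mQ; exists (l ^+ d)%R; rewrite ?exprn_gt0//.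
  by rewrite lebesgue_measure_Rd_cube.
split.
- rewrite -lee_pdivlMl ?invr_gt0//; apply/ereal_supP => _ [Q cQ <-].
  have [v v0 [mQ Qv]] := cubeE Q cQ.
  rewrite lee_pdivlMl ?invr_gt0// (A_characteristic_cubeE alpha q r s u sigma v0 Qv pp').
  have v1 : (0 < v `^ (alpha / d%:R) / v)%R by rewrite divr_gt0// powR_gt0.
  apply: (averaging_ge mQ v0 Qv p0 p'0 pp' q0 v1 r1 s1 wu wsigma) => f mf f1.
  apply: le_ereal_sup_tmp; eexists; first by exists Q.
  apply: ereal_sup_ubound; exists f => //.
  by rewrite (averaging_operatorE _ _ v0 Qv).
- apply/ereal_supP => _ [Q cQ <-]; have [v v0 [mQ Qv]] := cubeE Q cQ.
  apply/ereal_supP => _ [f [mf f1] <-].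
  have v1 : (0 < v `^ (alpha / d%:R) / v)%R by rewrite divr_gt0// powR_gt0.
  rewrite (averaging_operatorE _ _ v0 Qv).
  apply: le_trans (averaging_le mQ v0 Qv p'0 pp' q0 v1 r1 s1 wu wsigma C0
    (hC _ _ _) mf f1) _.
  apply: lee_wpmul2l; first by rewrite lee_fin ltW.
  rewrite -(A_characteristic_cubeE alpha q r s u sigma v0 Qv pp').
  by apply: ereal_sup_ubound; exists Q.
Qed.
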